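(* There exist a three-dimensional complex abelian variety $A$ and a holomorphic map $f:\mathbf{C}\to A$ with the following properties: (i) The image $f(\mathbf{C})$ is Zariski dense in $A$. (ii) Let $X$ denote the Zariski closure of the image of the first jet lift $J_1(f):\mathbf{C}\to J_1(A)\cong A\times\mathbf{C}^3$. Then $X$ is not a direct product inside $J_1(A)$, i.e., there does not exist an algebraic subvariety $W\subset\mathbf{C}^3$ such that $X=A\times W$.
   Context: The Zariski topology is the one given by algebraic subsets. $J_1(A)$ is the space of $1$-jets of holomorphic germs $(\mathbf{C},0)\to A$ (that is, the tangent bundle of $A$), canonically identified with $A\times\mathbf{C}^3$ by means of the trivialization of the tangent bundle by translations. Explicitly, if $\tilde f:\mathbf{C}\to\mathbf{C}^3$ is a lift of $f$ to the universal covering $\mathbf{C}^3\to A$ (a group homomorphism), then $J_1(f)=(f,\tilde f')$. *)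

(* Defs.v *)
From HB Require Import structures.
From mathcomp Require Import all_boot all_order all_algebra.
From mathcomp Require Import complex.
From mathcomp Require Import generic_quotient ring_quotient.
From mathcomp Require Import boolp classical_sets functions reals topology normedtype derive.
From mathcomp Require mpoly.
Import -(notations) mpoly.

Set Implicit Arguments.
Unset Strict Implicit.
Unset Printing Implicit Defensive.

Import Order.TTheory GRing.Theory Num.Theory.
Import numFieldNormedType.Exports.

Local Open Scope classical_set_scope.
Local Open Scope ring_scope.
Local Open Scope quotient_scope.

(* The field R[i] is packaged as a numClosedFieldType so that it receives the
   norm topology and the normed module structure over itself; differentiability
   over this field is complex differentiability. *)
Definition Cplx (R : realType) : numClosedFieldType := R[i].

Section Torus.
Variables (R : realType) (g : nat).
Local Notation C := (Cplx R).

(* The rows of the period matrix Pi are the periods. *)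
Definition lattice (Pi : 'M[C]_(g.*2, g)) : {pred 'rV[C]_g} :=
  fun z => `[< exists m : 'rV[int]_(g.*2), z = map_mx intr m *m Pi >].

(* R-linear independence of the 2g periods. *)
Definition is_period_matrix (Pi : 'M[C]_(g.*2, g)) : Prop :=
  forall c : 'rV[R]_(g.*2), map_mx (real_complex R) c *m Pi = 0 -> c = 0.

Variable Pi : 'M[C]_(g.*2, g).

Fact lattice_zmod_closed : zmod_closed (lattice Pi).
Proof.
split=> [|_ _ /asboolP[m ->] /asboolP[n ->]]; apply/asboolP.
  by exists 0; rewrite map_mx0 mul0mx.
by exists (m - n); rewrite map_mxB mulmxBl.
Qed.

HB.instance Definition _ :=
  GRing.isZmodClosed.Build 'rV[C]_g (lattice Pi) lattice_zmod_closed.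

Definition torus : Type := Quotient.quot (lattice Pi).
HB.instance Definition _ := ZmodQuotient.on torus.

Definition to_torus (z : 'rV[C]_g) : torus := \pi_torus z.

(* The map C^g / Lambda -> P^N sending a to the class of e a, where e is any
   set-theoretic choice of homogeneous coordinates, is a holomorphic embedding:
   it is well defined, injective, given near every point by a holomorphic
   vector G of homogeneous coordinates, and immersive.  The differential at z
   of [G] : C^g -> P^N kills v iff the derivative of G along v lies on the
   line spanned by G z.  The torus being compact, an injective immersion is an
   embedding. *)
Definition is_projective_embedding N (e : torus -> 'rV[C]_N.+1) : Prop :=
  [/\ forall a, e a != 0,
      forall a b, (exists c : C, e a = c *: e b) -> a = b &
      forall z, exists G : 'rV[C]_g -> 'rV[C]_N.+1,
        [/\ \forall w \near z, differentiable G w,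
            \forall w \near z, exists c : C, e (to_torus w) = c *: G w &
            forall v : 'rV[C]_g,
              (exists c : C, 'D_v G z = c *: G z) -> v = 0]].

End Torus.

(* A complex abelian variety is a complex torus that embeds in a projective
   space.  By Chow's theorem (and GAGA) the algebraic structure does not depend
   on the embedding. *)
Record abelianVariety (R : realType) (g : nat) := AbelianVariety {
  period : 'M[Cplx R]_(g.*2, g);
  periodP : is_period_matrix period;
  pdim : nat;
  hcoord : torus period -> 'rV[Cplx R]_pdim.+1;
  hcoordP : is_projective_embedding hcoord
}.

Definition points (R : realType) g (A : abelianVariety R g) : Type :=
  torus (period A).
Coercion points : abelianVariety >-> Sortclass.

Section Zariski.
Variables (R : realType) (g : nat) (A : abelianVariety R g).
Local Notation C := (Cplx R).

Definition homogeneous n (K : nzRingType) (p : mpoly.mpoly n K) : Prop :=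
  exists d, p \is mpoly.ishomog1 d (@mpoly.mdeg n : Measure.type n).

(* Algebraic subsets of A: common zeros of homogeneous polynomials. *)
Definition algebraic_set (Z : set A) : Prop :=
  exists S : set (mpoly.mpoly (pdim A).+1 C),
    (forall p, S p -> homogeneous p) /\
    Z = [set a | forall p, S p -> mpoly.meval (hcoord a 0) p = 0].

(* Algebraic subsets of C^n. *)
Definition algebraic_affine n (W : set 'rV[C]_n) : Prop :=
  exists S : set (mpoly.mpoly n C),
    W = [set v : 'rV[C]_n | forall p, S p -> mpoly.meval (v 0) p = 0].

(* Algebraic subsets of A x C^n: common zeros of polynomials which are
   homogeneous in the coordinates of the projective space and whose coefficients
   are polynomials in the coordinates of C^n. *)
Definition algebraic_prod n (Z : set (A * 'rV[C]_n)) : Prop :=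
  exists S : set (mpoly.mpoly (pdim A).+1 (mpoly.mpoly n C)),
    (forall p, S p -> homogeneous p) /\
    Z = [set x : A * 'rV[C]_n | forall p, S p ->
           mpoly.mmap (mpoly.meval (x.2 0)) (hcoord x.1 0) p = 0].

Definition zariski_dense (Y : set A) : Prop :=
  smallest algebraic_set Y = setT.

Definition zariski_closure n (Y : set (A * 'rV[C]_n)) : set (A * 'rV[C]_n) :=
  smallest (@algebraic_prod n) Y.

End Zariski.

Section Curves.
Variables (R : realType) (g : nat) (A : abelianVariety R g).
Local Notation C := (Cplx R).

(* F is a holomorphic lift of f to C^g on a neighbourhood of t. *)
Definition local_lift (f : C -> A) (t : C) (F : C -> 'rV[C]_g) : Prop :=
  \forall s \near t, derivable F s 1 /\ f s = to_torus (period A) (F s).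

(* C^g -> A being a local biholomorphism, these are the holomorphic maps. *)
Definition holomorphic (f : C -> A) : Prop :=
  forall t, exists F, local_lift f t F.

(* First jet lift of f, in the trivialization J_1(A) = A x C^g by translations;
   independent of the choice of F, see jetE. *)
Definition jet (f : C -> A) (t : C) : A * 'rV[C]_g :=
  (f t, derive1 (xget (cst 0) (local_lift f t)) t).

End Curves.

(* The jet is computed by any holomorphic lift. *)
Section JetE.
Variables (R : realType) (g : nat).
Local Notation C := (Cplx R).

Lemma to_torus_eq (Pi : 'M[C]_(g.*2, g)) (z w : 'rV[C]_g) :
  to_torus Pi z = to_torus Pi w <-> z - w \in lattice Pi.
Proof.
rewrite Quotient.idealrBE; split=> [zw|/eqP //]; exact/eqP.
Qed.

Lemma lattice_discrete (Pi : 'M[C]_(g.*2, g)) : is_period_matrix Pi ->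
  \forall z \near (0 : 'rV[C]_g), z \in lattice Pi -> z = 0.
Proof.
move=> PiP.
pose M : 'M[R]_(g.*2, g + g) :=
  row_mx (map_mx (@complex.Re R) Pi) (map_mx (@complex.Im R) Pi).
have cM (c : 'rV[R]_(g.*2)) : c *m M =
    row_mx (map_mx (@complex.Re R) (map_mx (real_complex R) c *m Pi))
           (map_mx (@complex.Im R) (map_mx (real_complex R) c *m Pi)).
  rewrite mul_mx_row; congr row_mx; apply/matrixP => i j; rewrite !mxE.
    rewrite raddf_sum; apply: eq_bigr => k _; rewrite !mxE.
    by case: (Pi k j) => a b /=; rewrite mul0r subr0.
  rewrite raddf_sum; apply: eq_bigr => k _; rewrite !mxE.
  by case: (Pi k j) => a b /=; rewrite mul0r addr0.
have Mfree : row_free M.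
  rewrite -kermx_eq0; apply/eqP/row_matrixP => i; rewrite row0.
  apply: PiP.
  have : row i (kermx M) *m M = 0 by rewrite -row_mul mulmx_ker row0.
  rewrite cM; move: (_ *m Pi) => w; rewrite -row_mx0.
  move=> /eq_row_mx[/matrixP re /matrixP im].
  apply/matrixP => k j; move: (re k j) (im k j); rewrite !mxE => re0 im0.
  by apply/eqP; rewrite eq_complex re0 im0 !eqxx.
pose N := pinvmx M.
pose K : R := 1 + \sum_j \sum_i `|N i j|.
have K1 : 1 <= K by rewrite lerDl; do 2!(apply: sumr_ge0 => ? _).
have K0 : 0 < K by apply: lt_le_trans K1.
have d0 : 0 < (real_complex R K^-1 : C) by rewrite ltcR invr_gt0.
have /= := nbhsx_ballx (0 : 'rV[C]_g) _ d0.
apply: filterS => z [_ zlt] /asboolP[m zE].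
suff m0 : m = 0 by rewrite zE m0 map_mx0 mul0mx.
have {}zlt k : ComplexField.Normc.normc (z 0 k) < K^-1.
  by have := zlt 0 k; rewrite mxE /ball /= sub0r normrN ltcR.
have mE : map_mx intr m =
    row_mx (map_mx (@complex.Re R) z) (map_mx (@complex.Im R) z) *m N.
  have -> : z = map_mx (real_complex R) (map_mx intr m) *m Pi.
    rewrite zE; congr (_ *m _); apply/matrixP => i j; rewrite !mxE.
    by rewrite rmorph_int.
  by rewrite -cM mulmxKp.
have vlt k : `|row_mx (map_mx (@complex.Re R) z) (map_mx (@complex.Im R) z) 0 k|
    <= K^-1.
  have le2 (a b : R) : `|a| <= Num.sqrt (a ^+ 2 + b ^+ 2).
    by rewrite -sqrtr_sqr ler_wsqrtr // lerDl sqr_ge0.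
  rewrite mxE; case: splitP => l _; rewrite mxE; apply/ltW/(le_lt_trans _ (zlt l)).
    by case: (z 0 l) => a b /=.
  by case: (z 0 l) => a b /=; rewrite addrC.
apply/matrixP => i j; rewrite ord1 [RHS]mxE {i}.
have : `|(m 0 j)%:~R| < 1 :> R.
  have -> : (m 0 j)%:~R = (map_mx intr m) 0 j :> R by rewrite mxE.
  rewrite mE mxE; apply: le_lt_trans (ler_norm_sum _ _ _) _.
  apply: (@le_lt_trans _ _ (K^-1 * \sum_i `|N i j|)).
    by rewrite mulr_sumr; apply: ler_sum => k _; rewrite normrM ler_wpM2r.
  rewrite mulrC ltr_pdivrMr // mul1r (le_lt_trans _ (ltr_pwDl ltr01 (lexx _))) //.
  rewrite (bigD1 j) //= lerDl; do 2!(apply: sumr_ge0 => ? _) => //.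
by rewrite -intr_norm ltrz1; case: (m 0 j) => [[]|].
Qed.

Lemma jetE (A : abelianVariety R g) (f : C -> A) (t : C) (F : C -> 'rV[C]_g) :
  local_lift f t F -> jet f t = (f t, derive1 F t).
Proof.
move=> Ff; have Gf := xgetI (cst 0) Ff; rewrite /jet.
move: (xget _ _) Gf => G Gf.
suff -> : derive1 G t = derive1 F t by [].
rewrite !derive1E; set H := F - G.
have dF := (nbhs_singleton Ff).1.
have dG := (nbhs_singleton Gf).1.
have dH : derivable H t 1 by exact: derivableB.
have cH : {for t, continuous H}.
  have /differentiable_continuous := (@derivable1_diffP _ _ H t).1 dH.
  exact.
have Hlat : \forall s \near t, H s \in lattice (period A).
  near=> s; apply/to_torus_eq.
  have [_ <-] : derivable F s 1 /\ f s = to_torus (period A) (F s) by near: s.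
  by have [_ <-] : derivable G s 1 /\ f s = to_torus (period A) (G s) by near: s.
have Hcst : \forall s \near t, H s = H t.
  have disc : \forall s \near t, H s - H t \in lattice (period A) ->
      H s - H t = 0.
    have : (fun s => H s - H t) @ t --> (0 : 'rV[C]_g).
      rewrite -[X in _ --> X](subrr (H t)).
      by apply: (@cvgB _ _ _ (nbhs t) _ H (cst (H t))); [exact: cH|exact: cvg_cst].
    by move=> /(_ _ (lattice_discrete (@periodP _ _ A))).
  near=> s; apply/subr0_eq.
  have Hs : H s \in lattice (period A) by near: s.
  have Ht : H t \in lattice (period A) by exact: nbhs_singleton Hlat.
  by have := rpredB Hs Ht; near: s.
have -> : F = G + H by apply/funext => s; rewrite /H !fctE addrC subrK.
rewrite (@deriveD _ _ _ G H t 1 dG dH).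
have -> : 'D_1 H t = 'D_1 (cst (H t)) t by exact: near_eq_derive.
by rewrite derive_cst addr0.
Unshelve. all: end_near.
Qed.

End JetE.

(* Main.v *)
From HB Require Import structures.
Require Import Defs.
From mathcomp Require Import all_boot all_order all_algebra finmap.
From mathcomp Require Import complex ring lra zify.
From mathcomp Require Import generic_quotient ring_quotient.
From mathcomp Require Import boolp classical_sets functions reals topology normedtype.
From mathcomp Require Import summability derive sequences realfun exp trigo.
From mathcomp Require mpoly.
Import -(notations) mpoly.

(** Let E be the quotient of the complex line by the lattice Lam spanned by
    2 pi i and ell = -8, and let A = E x E x E.  The theta functions of level
    two, B0 = [theta2 false] and B1 = [theta2 true], have a quotient which is a
    map of degree two from E to the projective line.  Let P0 and P1 be
    primitives of B0 and B1.  The entire curve is the image in A of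
<<
      t |-> (t, alpha P0(t), beta P0(t) + P1(t)).
>>
    Its velocity v at the time t satisfies
<<
      v_1 B1(x_0) = (alpha v_2 - beta v_1) B0(x_0),     x_0 = t,
>>
    which is an algebraic relation between the point x of A and the vector v,
    as [B0 : B1] is a rational function on E.  If the Zariski closure of the
    1-jets were A x W, the velocity of the curve at one time would satisfy the
    relation at every point x, and [B0 : B1] would be constant
    ([jet_closure_not_product]).

    The constant terms of the Fourier series of B0 and B1 are 1 and 0.  Hence
    adding 2 pi i k to t fixes the first coordinate of the curve modulo Lam and
    adds 2 pi i k (alpha, beta) to the two others.  The pair (alpha, beta) is
    chosen such that the multiples of 2 pi i (alpha, beta) are dense in E x E;
    it exists by the theorem of Baire ([exists_dense_multiples]).  As t is
    arbitrary, the curve is dense in A for the usual topology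
    ([exists_dense_curve_lift]), so that homogeneous polynomials that vanish on
    it vanish on A by continuity ([zariski_dense_curve]).

    It remains to embed A in a projective space.  Everything follows from the
    identity
<<
      theta(x + a) theta(x - a) = K e^(-a) (B0(x) B1(a) - B1(x) B0(a))
>>
    ([theta_split]), which is a rearrangement of double series, and from two
    properties of theta: it vanishes on Lam only ([theta_zero]), and its zero
    at the origin is simple ([dtheta0]).  Both come from the fact that theta(z)
    is close to 1 - e^z on a fundamental strip ([theta_estimate]).  The identity
    shows that B0 and B1 have no common zero, that [B0 : B1] takes the same
    value at x and y only if y = x or y = - x modulo Lam, and that it is an
    immersion at x unless 2 x lies in Lam.  The map [B0 : B1] and its translate
    by 2 compensate for each other, since 4 is not in Lam: together they embed
    E in a product of two projective lines.  This gives six maps from A to the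
    projective line, whose products, as in the Segre embedding, embed A in the
    projective space of dimension 63 ([segre_map_embedding]). *)

Set Implicit Arguments.
Unset Strict Implicit.
Unset Printing Implicit Defensive.

Import Order.TTheory GRing.Theory Num.Theory.
Import numFieldNormedType.Exports.
Import ComplexField.Normc.

Local Open Scope classical_set_scope.
Local Open Scope ring_scope.
Local Open Scope quotient_scope.

Existing Instance totally_filter.

(** * Unordered sums *)

(** The sum is the limit of the finite partial sums along the filter of all
    finite sets of indices: the order of the terms does not matter, which is
    what permits to reindex the series below by pairs of integers. *)
Definition has_sum (I : choiceType) (K : numFieldType) (u : I -> K) (s : K) :=
  \sum_(i <- A) u i @[A --> @totally I] --> s.

Section HasSum.
Variables (I : choiceType) (K : numFieldType).
Implicit Types (u v : I -> K) (s t : K).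

Lemma has_sumP u s :
  has_sum u s <->
  forall e, 0 < e -> exists A : {fset I}, forall B : {fset I},
    (A `<=` B)%fset -> `|s - \sum_(i <- B) u i| < e.
Proof.
split=> [/cvgrPdist_lt h e e0|h]; first by have [A _ hA] := h e e0; exists A.
by apply/cvgrPdist_lt => e /h[A hA]; exists A.
Qed.

Lemma eq_has_sum u v s : u =1 v -> has_sum u s -> has_sum v s.
Proof. by move=> /funext ->. Qed.

Lemma has_sum_unique u s t : has_sum u s -> has_sum u t -> s = t.
Proof. exact: norm_cvg_unique. Qed.

Lemma has_sumD u v s t :
  has_sum u s -> has_sum v t -> has_sum (fun i => u i + v i) (s + t).
Proof.
move=> us vt; rewrite /has_sum; under eq_fun do rewrite big_split.
exact: cvgD.
Qed.

Lemma has_sumMl (c : K) u s : has_sum u s -> has_sum (fun i => c * u i) (c * s).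
Proof.
move=> us; rewrite /has_sum; under eq_fun do rewrite -mulr_sumr.
exact: cvgMr.
Qed.

Lemma has_sumB u v s t :
  has_sum u s -> has_sum v t -> has_sum (fun i => u i - v i) (s - t).
Proof.
move=> us vt; rewrite /has_sum; under eq_fun do rewrite sumrB.
exact: cvgB.
Qed.

End HasSum.

Arguments has_sumMl {I K} c {u s}.

(** A finite set of indices is traded for its preimage under [phi]; the terms
    that are lost are zero.  With [phi] bijective this is invariance under
    permutation of the terms. *)
Lemma has_sum_reindex (I J : choiceType) (K : numFieldType) (phi : J -> I)
    (u : I -> K) (s : K) :
  injective phi -> (forall i, ~ range phi i -> u i = 0) ->
  has_sum (u \o phi) s -> has_sum u s.
Proof.
move=> inj u0 /has_sumP h; apply/has_sumP => e /h[A hA].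
exists [fset phi j | j in A]%fset => B AB.
(* [psi] is a partial inverse of [phi]. *)
pose psi i := if pselect (range phi i) is left H then Some (projT1 (cid2 H)) else None.
have psiK j : psi (phi j) = Some j.
  rewrite /psi; case: pselect => [H|[]]; last by exists j.
  by case: cid2 => j' /= _ /inj ->.
have psi_inv i j : psi i = Some j -> phi j = i.
  by rewrite /psi; case: pselect => // H [<-]; case: cid2.
have psi_inv' : ocancel psi phi.
  by move=> i; case E : (psi i) => [j|] //=; exact: psi_inv.
pose B' := [fset j | j in pmap psi B]%fset.
have -> : \sum_(i <- B) u i = \sum_(j <- B') u (phi j).
  rewrite (perm_big (pmap psi B))/=; last first.
    apply: uniq_perm; first exact: fset_uniq.
      exact/(pmap_uniq psi_inv')/fset_uniq.
    by move=> j; rewrite /B' inE.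
  rewrite big_pmap; apply: eq_bigr => i _.
  rewrite /psi; case: pselect => [H|/u0 //]/=.
  by case: cid2 => j _ /= ->.
apply: hA; apply/fsubsetP => j jA; rewrite inE/= mem_pmap; apply/mapP.
exists (phi j); last by rewrite psiK.
by apply: (fsubsetP AB); apply/imfsetP; exists j.
Qed.

Lemma ler_sum_fset (I : choiceType) (R : numDomainType) (u : I -> R)
    (A B : {fset I}) :
  (forall i, 0 <= u i) -> (A `<=` B)%fset ->
  \sum_(i <- A) u i <= \sum_(i <- B) u i.
Proof.
move=> u0 AB; rewrite [leRHS](big_fsetID _ (mem A))/=.
have -> : [fset x in B | x \in A]%fset = A.
  apply/fsetP => x; rewrite !inE andbC; case xA: (x \in A) => //=.
  exact: (fsubsetP AB).
by rewrite lerDl sumr_ge0.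
Qed.

(** The sum is the supremum of the partial sums. *)
Lemma ge0_bounded_has_sum (I : choiceType) (R : realType) (u : I -> R) (M : R) :
  (forall i, 0 <= u i) -> (forall A : {fset I}, \sum_(i <- A) u i <= M) ->
  exists s, has_sum u s.
Proof.
move=> u0 uM; pose S := range (fun A : {fset I} => \sum_(i <- A) u i).
have hS : has_sup S.
  split; first by exists (\sum_(i <- fset0) u i), fset0.
  by exists M => _ [A _ <-].
exists (sup S); apply/has_sumP => e e0.
have [_ [A _ <-] Ae] := sup_adherent e0 hS.
exists A => B AB; rewrite ger0_norm; last first.
  by rewrite subr_ge0; apply: (ub_le_sup hS.2); exists B.
rewrite ltrBlDl -ltrBlDr (lt_le_trans Ae)//.
exact: ler_sum_fset.
Qed.

Lemma has_sum_fin (I : choiceType) (K : numFieldType) (u : I -> K) (A : {fset I}) :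
  (forall i, i \notin A -> u i = 0) -> has_sum u (\sum_(i <- A) u i).
Proof.
move=> u0; apply/has_sumP => e e0; exists A => B AB.
by rewrite (big_fset_incl _ AB) ?subrr ?normr0// => i _ /u0.
Qed.

Lemma sum_fsetM (I J : choiceType) (V : nmodType) (u : I * J -> V)
    (A : {fset I}) (B : {fset J}) :
  \sum_(p <- (A `*` B)%fset) u p = \sum_(i <- A) \sum_(j <- B) u (i, j).
Proof. by rewrite /fsetM big_imfset2//= => -[? ?] [? ?] _ _ /= [-> ->]. Qed.

Section Complex.
Variable R : realType.
Local Notation C := (Cplx R).

Lemma normcE (z : C) : `|z| = (real_complex R (normc z) : C).
Proof. by []. Qed.

Lemma normc_ge0 (z : C) : 0 <= normc z.
Proof. by have := normr_ge0 z; rewrite normcE ler0c. Qed.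

Lemma normc_sum (I : Type) (r : seq I) (P : pred I) (u : I -> C) :
  normc (\sum_(i <- r | P i) u i) <= \sum_(i <- r | P i) normc (u i).
Proof.
elim/big_ind2: _ => //; first by rewrite normc0.
by move=> x1 x2 y1 y2 h1 h2; apply: le_trans (le_normcD _ _) (lerD h1 h2).
Qed.

Definition summable (I : choiceType) (u : I -> C) :=
  exists M : R, forall A : {fset I}, \sum_(i <- A) normc (u i) <= M.

Lemma has_sum_normc (I : choiceType) (u : I -> C) (s : C) (M : R) :
  has_sum u s -> (forall A : {fset I}, \sum_(i <- A) normc (u i) <= M) ->
  normc s <= M.
Proof.
move=> /has_sumP us uM; apply/ler_addgt0Pr => e e0.
have e0' : 0 < (real_complex R e : C) by rewrite ltcR.
have [A /(_ A (fsubset_refl _))] := us _ e0'.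
rewrite normcE ltcR => sA.
rewrite -(subrK (\sum_(i <- A) u i) s) addrC.
apply: le_trans (le_normcD _ _) _.
rewrite lerD//; first exact: le_trans (normc_sum _ _ _) (uM _).
exact: ltW.
Qed.

Lemma has_sum_real (I : choiceType) (u : I -> R) (s : R) :
  has_sum u s -> has_sum (fun i => real_complex R (u i) : C) (real_complex R s : C).
Proof.
move=> /has_sumP h; apply/has_sumP => -[e e'] /=.
rewrite ltcE/= => /andP[/eqP -> e0]; have [A hA] := h _ e0.
exists A => B /hA sB.
have -> : \sum_(i <- B) (real_complex R (u i) : C) =
  real_complex R (\sum_(i <- B) u i) by rewrite raddf_sum.
have -> : (real_complex R s : C) - real_complex R (\sum_(i <- B) u i) =
  real_complex R (s - \sum_(i <- B) u i) by rewrite rmorphB.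
by rewrite normcE /= ltcE/= eqxx/= expr0n/= addr0 sqrtr_sqr.
Qed.

Lemma normr_Re_le (z : C) : `|complex.Re z| <= normc z.
Proof.
by case: z => a b /=; rewrite -sqrtr_sqr ler_wsqrtr // lerDl sqr_ge0.
Qed.

Lemma normr_Im_le (z : C) : `|complex.Im z| <= normc z.
Proof.
by case: z => a b /=; rewrite -sqrtr_sqr ler_wsqrtr // lerDr sqr_ge0.
Qed.

(** Write [u] as the difference of the nonnegative families [u + `|u|] and
    [`|u|]. *)
Lemma abs_bounded_has_sum (I : choiceType) (u : I -> R) (M : R) :
  (forall A : {fset I}, \sum_(i <- A) `|u i| <= M) -> exists s, has_sum u s.
Proof.
move=> uM.
have [s1 hs1] : exists s, has_sum (fun i => `|u i|) s by apply: ge0_bounded_has_sum uM.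
have [s2 hs2] : exists s, has_sum (fun i => u i + `|u i|) s.
  apply: (@ge0_bounded_has_sum _ _ _ (M + M)) => [i|A].
    by rewrite addrC -[X in _ + X]opprK subr_ge0 -normrN ler_norm.
  rewrite big_split/= lerD//; apply: le_trans (uM A).
  by apply: ler_sum => i _; exact: ler_norm.
exists (s2 - s1); have := has_sumB hs2 hs1.
by under eq_fun do rewrite addrK.
Qed.

Lemma summable_has_sum (I : choiceType) (u : I -> C) :
  summable u -> exists s, has_sum u s.
Proof.
move=> [M uM].
have [s1 /has_sum_real hs1] : exists s, has_sum (fun i => complex.Re (u i)) s.
  apply: (@abs_bounded_has_sum _ _ M) => A; apply: le_trans (uM A).
  by apply: ler_sum => i _; exact: normr_Re_le.
have [s2 /has_sum_real hs2] : exists s, has_sum (fun i => complex.Im (u i)) s.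
  apply: (@abs_bounded_has_sum _ _ M) => A; apply: le_trans (uM A).
  by apply: ler_sum => i _; exact: normr_Im_le.
have h := has_sumD hs1 (has_sumMl ('i%C : C) hs2); eexists.
suff -> : u = fun i => (real_complex R (complex.Re (u i)) : C) + 'i%C * real_complex R (complex.Im (u i)).
  exact: h.
by apply/funext => i; rewrite [LHS]complexE.
Qed.

Lemma summableM (I J : choiceType) (u : I -> C) (v : J -> C) :
  summable u -> summable v -> summable (fun p : I * J => u p.1 * v p.2).
Proof.
move=> [M uM] [N vN]; exists (M * N) => A.
pose A1 := [fset p.1 | p in A]%fset; pose A2 := [fset p.2 | p in A]%fset.
apply: (@le_trans _ _ (\sum_(p <- (A1 `*` A2)%fset) normc (u p.1 * v p.2))).
  apply: ler_sum_fset => [p|]; first exact: normc_ge0.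
  apply/fsubsetP => p pA; rewrite in_fsetM.
  by apply/andP; split; apply/imfsetP; exists p.
rewrite sum_fsetM/=.
under eq_bigr => i _ do under eq_bigr => j _ do rewrite normcM.
under eq_bigr => i _ do rewrite -mulr_sumr.
rewrite -mulr_suml ler_pM//; apply: sumr_ge0 => i _; exact: normc_ge0.
Qed.

(** The double family has a sum by absolute summability.  The sum is s * t,
    because it is approached along the rectangles, which are cofinal among the
    finite sets of pairs. *)
Lemma has_sumM (I J : choiceType) (u : I -> C) (v : J -> C) (s t : C) :
  summable u -> summable v -> has_sum u s -> has_sum v t ->
  has_sum (fun p : I * J => u p.1 * v p.2) (s * t).
Proof.
move=> su sv us vt; have [w hw] := summable_has_sum (summableM su sv).
suff -> : s * t = w by [].
apply/eqP; rewrite -subr_eq0 -normr_eq0; apply: contraT => d0.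
have {}d0 : 0 < `|s * t - w| / 2 by rewrite divr_gt0// normr_gt0 -normr_eq0.
have [A hA] := (has_sumP _ _).1 hw _ d0.
pose f (B : {fset I} * {fset J}) :=
  (\sum_(i <- B.1) u i) * (\sum_(j <- B.2) v j).
have : f @ filter_prod (@totally I) (@totally J) --> s * t.
  apply: cvgM.
    exact: (@cvg_comp _ _ _ (@fst {fset I} {fset J}) (fun A : {fset I} => \sum_(i <- A) u i) _ _ _ cvg_fst us).
  exact: (@cvg_comp _ _ _ (@snd {fset I} {fset J}) (fun A : {fset J} => \sum_(i <- A) v i) _ _ _ cvg_snd vt).
move=> /cvgrPdist_lt/(_ _ d0)[[P1 P2] /= [[A1 _ h1] [A2 _ h2]] h].
pose B1 := (A1 `|` [fset p.1 | p in A])%fset.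
pose B2 := (A2 `|` [fset p.2 | p in A])%fset.
have lt1 : `|s * t - f (B1, B2)| < `|s * t - w| / 2.
  apply: h; split; [apply: h1|apply: h2]; exact: fsubsetUl.
have /hA : (A `<=` B1 `*` B2)%fset.
  apply/fsubsetP => p pA; rewrite in_fsetM !inE.
  by apply/andP; split; apply/orP; right; apply/imfsetP; exists p.
rewrite sum_fsetM/=.
under eq_bigr => i _ do rewrite -mulr_sumr.
rewrite -mulr_suml -/(f (B1, B2)) => lt2; move: (ltrD lt1 lt2).
rewrite -splitr [X in _ + X]distrC => /(le_lt_trans (ler_normD _ _)).
by rewrite addrA subrK ltxx.
Qed.
End Complex.

(** * Estimates for the real exponential, sine and cosine *)
Section RealBounds.
Variable R : realType.
Implicit Types x y : R.

Lemma expR_sub1_le x : expR x - 1 <= x * expR x.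
Proof.
have := expR_ge1Dx (- x); rewrite expRN => h.
have e0 := expR_gt0 x.
have := ler_wpM2r (ltW e0) h; rewrite mulVf ?gt_eqF//; lra.
Qed.

Lemma normr_expR_sub1 x : `|expR x - 1| <= `|x| * expR `|x|.
Proof.
have [x0|x0] := leP 0 x.
  rewrite !ger0_norm// ?expR_sub1_le//.
  by rewrite subr_ge0 -[leLHS]expR0 ler_expR.
rewrite ltr0_norm; last by rewrite subr_lt0 expR_lt1.
have h1 := expR_ge1Dx x.
rewrite (ltr0_norm x0); apply: (@le_trans _ _ (- x)); first by lra.
by rewrite ler_peMr ?oppr_ge0 1?ltW// expR_gt1 oppr_gt0.
Qed.

Lemma normr_expR_sub1x x : `|expR x - 1 - x| <= `|x| ^+ 2 * expR `|x|.
Proof.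
have h1 := expR_ge1Dx x; rewrite ger0_norm; last by lra.
have h2 := expR_sub1_le x.
apply: (@le_trans _ _ (x * (expR x - 1))); first by lra.
apply: (le_trans (ler_norm _)).
by rewrite normrM expr2 -mulrA ler_wpM2l// normr_expR_sub1.
Qed.

Lemma normr_sin_le y : `|sin y| <= `|y|.
Proof.
wlog y0 : y / 0 < y.
  move=> h; have [/h//|y0|<-] := ltgtP 0 y; last by rewrite sin0.
  by rewrite -normrN -sinN -[leRHS]normrN; apply: h; rewrite oppr_gt0.
have := @MVT R sin cos 0 y y0.
case=> [|c].
  by apply: continuous_subspaceT => x; exact: continuous_sin.
move=> _; rewrite sin0 !subr0 => ->.
by rewrite normrM ler_piMl// cos_max.
Qed.

Lemma normr_cos_sub1 y : `|cos y - 1| <= `|y| ^+ 2.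
Proof.
have -> : cos y - 1 = - (sin (y / 2) ^+ 2 *+ 2).
  have -> : cos y = cos (y / 2 *+ 2) by congr cos; rewrite mulr2n; lra.
  by rewrite cos_mulr2n cos2sin2 !mulr2n; lra.
rewrite normrN normrMn normrX.
have := normr_sin_le (y / 2); rewrite normrM (ger0_norm (_ : 0 <= 2^-1)) ?invr_ge0//.
move=> h; have := ler_pM (normr_ge0 _) (normr_ge0 _) h h.
have := mulr_ge0 (normr_ge0 y) (normr_ge0 y).
by rewrite !expr2; lra.
Qed.

Lemma normr_sin_subx y : `|sin y - y| <= `|y| ^+ 2 * `|y|.
Proof.
wlog y0 : y / 0 < y.
  move=> h; have [/h//|y0|<-] := ltgtP 0 y; last by rewrite sin0 subrr normr0 mulr0.
  have := h (- y); rewrite sinN normrN -opprD normrN.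
  by apply; rewrite oppr_gt0.
have := @MVT R sin cos 0 y y0.
case=> [|c].
  by apply: continuous_subspaceT => x; exact: continuous_sin.
rewrite in_itv/= => /andP[c0 cy]; rewrite sin0 !subr0 => ->.
rewrite -[X in _ - X]mul1r -mulrBl normrM ler_wpM2r//.
apply: le_trans (normr_cos_sub1 c) _.
by rewrite ler_sqr ?nnegrE// !gtr0_norm// ltW.
Qed.

Lemma cosD2pi_int y (k : int) : cos (y + pi *+ 2 * k%:~R) = cos y.
Proof.
have nat_case (z : R) n : cos (z + pi *+ 2 * n%:R) = cos z.
  by rewrite mulr_natr; exact: (periodicn (@cosD2pi R)).
case: k => n; first by rewrite -pmulrn nat_case.
rewrite NegzE mulrNz mulrN -pmulrn.
by rewrite -[in RHS](subrK (pi *+ 2 * n.+1%:R) y) nat_case.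
Qed.

Lemma cos_eq1 y : cos y = 1 -> exists k : int, y = pi *+ 2 * k%:~R.
Proof.
move=> y1; have p0 := pi_gt0 R; have p20 : 0 < pi *+ 2 :> R by rewrite mulrn_wgt0.
pose k := Num.floor (y / (pi *+ 2)).
have /andP[k1 k2] := mem_rg1_floor (y / (pi *+ 2)).
exists k; apply/eqP; rewrite -subr_eq0; apply/eqP.
pose x := y - pi *+ 2 * k%:~R; rewrite -/x.
have x1 : cos x = 1 by rewrite /x -mulrN -mulrNz cosD2pi_int.
have x0 : 0 <= x by rewrite subr_ge0 mulrC -ler_pdivlMr.
have x2 : x < pi *+ 2.
  by move: k2; rewrite ltr_pdivrMr// -/k /x; lra.
have pin (z : R) : 0 <= z <= pi -> cos z = 1 -> z = 0.
  move=> z0 z1; apply: cos_inj; rewrite ?in_itv//= ?lexx ?ltW//.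
  by rewrite cos0.
have [xpi|xpi] := leP x pi; first by apply: pin; rewrite ?x0.
have : pi *+ 2 - x = 0.
  apply: pin; first by rewrite mulr2n; apply/andP; split; move: x2; rewrite mulr2n; lra.
  by rewrite addrC cosD2pi cosN.
by move/eqP; rewrite subr_eq0 => /eqP h; rewrite -h ltxx in x2.
Qed.
End RealBounds.

(** * Products of pairs of functions *)

(** [u k] stands for the two homogeneous coordinates of the k-th point of a
    product of projective lines; the Segre coordinates are the products
    of [u k (e k)] over [k], for all choices [e]. *)
Section SegreAlgebra.
Variables (F : fieldType) (K : finType).
Implicit Types (u v : K -> bool -> F) (e : {ffun K -> bool}).

Definition upd e k i : {ffun K -> bool} := [ffun k' => if k' == k then i else e k'].

Lemma prod_upd u e k i :
  \prod_k' u k' (upd e k i k') = u k i * \prod_(k' | k' != k) u k' (e k').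
Proof.
rewrite (bigD1 k)//= ffunE eqxx; congr (_ * _).
by apply: eq_bigr => k' /negbTE k'k; rewrite ffunE k'k.
Qed.

Lemma segre_nonzero u : (forall k, exists i, u k i != 0) ->
  exists e, forall k, u k (e k) != 0.
Proof.
move=> /choice[e he]; exists [ffun k => e k] => k; rewrite ffunE; exact: he.
Qed.

(** Fix the choice at all indices but [k] so that the other factors of [u] do not
    vanish: the two Segre coordinates obtained by varying the choice at [k] are
    proportional to [u k false] and [u k true], respectively for [v]. *)
Lemma segre_inj u v (c : F) : (forall k, exists i, u k i != 0) ->
  (forall e, \prod_k u k (e k) = c * \prod_k v k (e k)) ->
  forall k, u k false * v k true = u k true * v k false.
Proof.
move=> /segre_nonzero[e he] h k.
pose P := \prod_(k' | k' != k) u k' (e k').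
pose Q := \prod_(k' | k' != k) v k' (e k').
have P0 : P != 0 by apply/prodf_neq0 => k' _.
have hi i : u k i * P = c * Q * v k i.
  by have := h (upd e k i); rewrite !prod_upd -/P -/Q => ->; ring.
have cQ0 : c * Q != 0.
  apply/eqP => cQ; have := mulf_neq0 (he k) P0.
  by rewrite hi cQ mul0r eqxx.
apply: (mulfI (mulf_neq0 cQ0 P0)).
transitivity ((u k false * P) * (c * Q * v k true)); first by ring.
by rewrite hi -(hi true); ring.
Qed.
End SegreAlgebra.

(** * Differentiability of products, row vectors and polynomials *)
Section Differentiability.
Variable K : numFieldType.

Lemma differentiable_prod (V : normedModType K) (I : Type) (r : seq I)
    (P : pred I) (f : I -> V -> K) (x : V) :
  (forall i, differentiable (f i) x) ->
  differentiable (fun z => \prod_(i <- r | P i) f i z) x.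
Proof.
move=> df; elim: r => [|i r IH].
  by under eq_fun do rewrite big_nil; exact: differentiable_cst.
under eq_fun do rewrite big_cons.
case: (P i) => //; exact: (differentiableM (df i) IH).
Qed.

Lemma differentiable_row (V : normedModType K) n (f : V -> 'rV[K]_n.+1) (x : V) :
  (forall j, differentiable (fun z => f z 0 j) x) -> differentiable f x.
Proof.
move=> df.
have -> : f = \sum_(j < n.+1) (fun z => f z 0 j *: delta_mx 0 j).
  apply/funext => z; rewrite fct_sumE; exact: row_sum_delta.
by apply: differentiable_sum => j; exact: differentiableZl.
Qed.

Lemma derive_coord (V : normedModType K) n (f : V -> 'rV[K]_n.+1) (x v : V) j :
  derivable f x v -> 'D_v (fun z => f z 0 j) x = ('D_v f x) 0 j.
Proof.
move=> df; apply/cvg_lim; first exact: norm_hausdorff.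
have := @cvg_comp _ _ _ _ (fun M : 'rV[K]_n.+1 => M 0 j) _ _ _ df (@coord_continuous K 1 n.+1 0 j _).
apply: cvg_trans; apply: near_eq_cvg; near=> h.
by rewrite /= !mxE.
Unshelve. all: by end_near.
Qed.
End Differentiability.

Section Mpoly.
Variable K : numFieldType.

Lemma differentiable_meval (V : normedModType K) n (f : V -> 'rV[K]_n.+1)
    (p : mpoly.mpoly n.+1 K) (x : V) :
  differentiable f x -> differentiable (fun z => mpoly.meval (f z 0) p) x.
Proof.
move=> df; under eq_fun do rewrite mpoly.mevalE.
elim: (mpoly.msupp p) => [|m r IH].
  by under eq_fun do rewrite big_nil; exact: differentiable_cst.
under eq_fun do rewrite big_cons.
apply: differentiableD IH.
apply: (@differentiableM _ _ (cst (mpoly.mcoeff m p))); first exact: differentiable_cst.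
apply: differentiable_prod => i.
have dfi : differentiable (fun z => f z 0 i) x.
  exact: (differentiable_comp df (differentiable_coord (f x) 0 i)).
elim: (m i) => [|k IHk]; first by under eq_fun do rewrite expr0; exact: differentiable_cst.
by under eq_fun do rewrite exprS; exact: (differentiableM dfi IHk).
Qed.

Lemma meval_homogeneous n (v : 'I_n -> K) (c : K) (p : mpoly.mpoly n K) :
  homogeneous p -> exists d, mpoly.meval (fun i => c * v i) p = c ^+ d * mpoly.meval v p.
Proof.
move=> [d hp]; exists d; rewrite !mpoly.mevalE mulr_sumr.
have hp' := mpoly.dhomogP _ _ _ hp.
rewrite big_seq [RHS]big_seq; apply: eq_bigr => m /hp' md.
rewrite mulrCA; congr (_ * _).
under eq_bigr do rewrite exprMn.
have <- : mpoly.mdeg m = d := md.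
by rewrite big_split/= mpoly.mdegE expr_sum.
Qed.

(** The equation c1(v) X_l1 = c2(v) X_l2, of degree one in the projective
    coordinates X. *)
Definition binom_poly n N (c1 c2 : mpoly.mpoly n K) (l1 l2 : 'I_N) :
    mpoly.mpoly N (mpoly.mpoly n K) :=
  c1 *: mpoly.mpolyX _ (mpoly.mnm1 l1) - c2 *: mpoly.mpolyX _ (mpoly.mnm1 l2).

Lemma binom_polyE n N (c1 c2 : mpoly.mpoly n K) (l1 l2 : 'I_N) w h :
  mpoly.mmap (mpoly.meval w) h (binom_poly c1 c2 l1 l2) =
  mpoly.meval w c1 * h l1 - mpoly.meval w c2 * h l2.
Proof. by rewrite /binom_poly mpoly.mmapB !mpoly.mmapZ !mpoly.mmapX !mpoly.mmap1U. Qed.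

Lemma binom_poly_homogeneous n N (c1 c2 : mpoly.mpoly n K) (l1 l2 : 'I_N) :
  homogeneous (binom_poly c1 c2 l1 l2).
Proof.
exists 1%N; apply: rpredB; apply: rpredZ; rewrite mpoly.dhomogX;
  apply/eqP; exact: mpoly.mdeg1.
Qed.
End Mpoly.

(** * A vector with dense multiples modulo integers *)
HB.instance Definition _ (R : realType) (n : nat) := Complete.on 'rV[R]_n.+1.

Section Kronecker.
Variables (R : realType) (n : nat).
Local Notation V := 'rV[R]_n.+1.

Definition approx (s : V) (e : R) : set V :=
  [set r | exists k : nat, exists m : 'I_n.+1 -> int,
     forall i, `|k%:R * r 0 i - (m i)%:~R - s 0 i| < e].

Lemma open_approx s e : open (approx s e).
Proof.
suff nbh (r : V) : approx s e r -> nbhs r (approx s e).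
  by rewrite openE => r; exact: nbh.
move=> [k [m h]].
have : \forall r' \near r, forall i, `|k%:R * (r' : V) 0 i - (m i)%:~R - s 0 i| < e.
  suff : forall i, \forall r' \near r, `|k%:R * (r' : V) 0 i - (m i)%:~R - s 0 i| < e.
    exact: filter_forall (nbhs_filter r).
  move=> i.
  have c0 : (fun r' : V => r' 0 i) @ r --> r 0 i by exact: (@coord_continuous R 1 n.+1 0 i r).
  have c1 : (fun r' : V => k%:R * r' 0 i - (m i)%:~R - s 0 i) @ r -->
      k%:R * r 0 i - (m i)%:~R - s 0 i.
    have c2 : (fun r' : V => k%:R * r' 0 i) @ r --> k%:R * r 0 i.
      by apply: cvgM c0; exact: cvg_cst.
    have cvgc (c : R) : (fun r' : V => c) @ r --> c.
      by have := @cvg_cst R c V (nbhs r) _; exact.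
    exact: cvgB (cvgB c2 (cvgc _)) (cvgc _).
  exact: cvgr_lt (cvg_norm c1) _ (h i).
by apply: filterS => r' hr'; exists k, m.
Qed.

(** The vectors (m + s) / k, with [m] integral, form a grid of mesh 1 / k, and
    k (m + s) / k = s modulo integers. *)
Lemma dense_approx s e : 0 < e -> dense (approx s e).
Proof.
move=> e0 O [r0 r0O] oO.
have /nbhs_ballP[d /= d0 hd] : nbhs r0 O by exact: open_nbhs_nbhs.
pose k := (Num.truncn d^-1).+1.
have k0 : 0 < k%:R :> R by rewrite ltr0n.
have kd : k%:R^-1 < d.
  by rewrite invf_plt ?posrE// truncnS_gt.
pose m i := Num.floor (k%:R * r0 0 i - s 0 i).
pose r : V := \row_i (((m i)%:~R + s 0 i) / k%:R).
exists r; split.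
  apply: hd; split=> // a0 i; rewrite ord1 /ball/= /r mxE.
  have /andP[h1 h2] := mem_rg1_floor (k%:R * r0 0 i - s 0 i).
  apply: lt_trans kd.
  suff key (a x y : R) : a <= k%:R * x - y -> k%:R * x - y < a + 1 ->
      `|x - (a + y) / k%:R| < k%:R^-1 by exact: key.
  move=> {}h1 {}h2; have kk : k%:R * k%:R^-1 = 1 :> R by rewrite divff// gt_eqF.
  have -> : x - (a + y) / k%:R = (k%:R * x - (a + y)) * k%:R^-1.
    by rewrite mulrBl mulrAC kk mul1r.
  have i0 : 0 < k%:R^-1 :> R by rewrite invr_gt0.
  rewrite normrM (gtr0_norm i0) gtr_pMl// ger0_norm; lra.
exists k, m => i; rewrite mxE.
by rewrite mulrCA divff ?gt_eqF// mulr1 addrAC addrK subrr normr0.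
Qed.

(** Baire: the sets [approx s e] with rational [s] and e = 1 / (l + 1) are
    countably many dense open sets, hence have a common point. *)
Theorem exists_dense_multiples : exists r : V,
  forall s e, 0 < e -> approx s e r.
Proof.
pose F j : set V :=
  if @choice.unpickle ('rV[rat]_n.+1 * nat)%type j is Some (s, l) then
    approx (map_mx ratr s) l.+1%:R^-1 else setT.
have oF j : open (F j) /\ dense (F j).
  rewrite /F; case: choice.unpickle => [[s l]|].
    by split; [exact: open_approx|apply: dense_approx; rewrite invr_gt0 ltr0n].
  by split; [exact: openT|move=> O O0 _; rewrite setIT].
have [r [_ hr]] := Baire oF (ex_intro setT (0 : V) I) openT.
exists r => s e e0.
pose l := Num.truncn (2 / e).
have /choice[s' hs'] : forall i, exists x : rat, `|ratr x - s 0 i| < e / 2.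
  move=> i.
  have [|x] := @rat_in_itvoo R (s 0 i - e / 2) (s 0 i + e / 2); first by lra.
  by rewrite in_itv/= => /andP[? ?]; exists x; rewrite ltr_norml; apply/andP; split; lra.
have := hr (choice.pickle (\row_i s' i : 'rV[rat]_n.+1, l)) I.
rewrite /F choice.pickleK => -[k [m h]]; exists k, m => i.
have le : l.+1%:R^-1 < e / 2 by rewrite invf_plt ?posrE ?divr_gt0// invf_div truncnS_gt.
have key (u x y d : R) : d < e / 2 -> `|x - y| < e / 2 -> `|u - x| < d -> `|u - y| < e.
  by rewrite !ltr_norml => ? /andP[? ?] /andP[? ?]; apply/andP; split; lra.
by have := h i; rewrite !mxE; exact: key le (hs' i).
Qed.
End Kronecker.

Section Construction.
Variable R : realType.
Local Notation C := (Cplx R).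
Local Notation Re := (@complex.Re R).
Local Notation Im := (@complex.Im R).
Local Notation rc := (real_complex R).

(** * The complex exponential *)

Definition cexp (z : C) : C :=
  Complex (expR (Re z) * cos (Im z)) (expR (Re z) * sin (Im z)).

Lemma cexp0 : cexp 0 = 1.
Proof. by rewrite /cexp/= expR0 cos0 sin0 !mul1r. Qed.

Lemma cexpD z w : cexp (z + w) = cexp z * cexp w.
Proof.
case: z w => [a b] [c d]; rewrite /cexp/=.
rewrite -[LHS]/(Complex _ _) expRD cosD sinD; congr Complex; ring.
Qed.

Lemma cexp_neq0 z : cexp z != 0.
Proof.
apply/eqP => h; have := cexpD z (- z); rewrite subrr cexp0 h mul0r => /eqP.
by rewrite oner_eq0.
Qed.

Lemma cexpN z : cexp (- z) = (cexp z)^-1.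
Proof.
apply: (mulfI (cexp_neq0 z)); rewrite -cexpD subrr cexp0 divff//.
exact: cexp_neq0.
Qed.

Lemma normc_cexp z : normc (cexp z) = expR (Re z).
Proof.
case: z => a b; rewrite /cexp/= !exprMn -mulrDr cos2Dsin2 mulr1 sqrtr_sqr.
by rewrite ger0_norm// expR_ge0.
Qed.

Lemma normc_le (z : C) : normc z <= `|Re z| + `|Im z|.
Proof.
case: z => a b /=; rewrite -[leRHS]ger0_norm ?addr_ge0// -sqrtr_sqr.
rewrite ler_wsqrtr// -(real_normK (num_real a)) -(real_normK (num_real b)).
have := normr_ge0 a; have := normr_ge0 b; nra.
Qed.

(** Second order remainder of the exponential, with a bound that is uniform on
    bounded sets. *)
Lemma normc_cexp_sub1x z :
  normc (cexp z - 1 - z) <= 5 * normc z ^+ 2 * expR (normc z).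
Proof.
set r := normc z; have r0 : 0 <= r by exact: normc_ge0.
set E := expR r; have E0 : 0 < E by exact: expR_gt0.
have bR : `|Re z| <= r := normr_Re_le z.
have bI : `|Im z| <= r := normr_Im_le z.
have eE : expR (Re z) <= E by rewrite ler_expR (le_trans (ler_norm _)).
have eE' : expR `|Re z| <= E by rewrite ler_expR.
have e0 := expR_ge0 (Re z); have e0' := expR_ge0 `|Re z|.
have h1 := normr_expR_sub1 (Re z); have h2 := normr_expR_sub1x (Re z).
have h3 := normr_cos_sub1 (Im z).
have h4 : `|sin (Im z) - Im z| <= `|Im z| ^+ 2 *+ 2.
  have := normr_sin_subx (Im z); have := normr_sin_le (Im z).
  have := ler_normB (sin (Im z)) (Im z); have := normr_ge0 (Im z).
  by rewrite mulr2n; have [|] := leP `|Im z| 1; nra.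
apply: (le_trans (normc_le _)).
have -> : Re (cexp z - 1 - z) = (expR (Re z) - 1 - Re z) + expR (Re z) * (cos (Im z) - 1).
  by case: (z) => a b; rewrite /cexp/=; ring.
have -> : Im (cexp z - 1 - z) = expR (Re z) * (sin (Im z) - Im z) + (expR (Re z) - 1) * Im z.
  by case: (z) => a b; rewrite /cexp/=; ring.
have n0 := normr_ge0 (Re z); have n0' := normr_ge0 (Im z).
have s1 : `|Re z| ^+ 2 <= r ^+ 2 by rewrite ler_sqr ?nnegrE.
have s2 : `|Im z| ^+ 2 <= r ^+ 2 by rewrite ler_sqr ?nnegrE.
have -> : 5 * r ^+ 2 * E = (r ^+ 2 * E + E * r ^+ 2) + (E * (r ^+ 2 *+ 2) + (r * E) * r) by ring.
rewrite lerD//; apply: (le_trans (ler_normD _ _)); apply: lerD; rewrite ?normrM ?(ger0_norm e0).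
- by apply: le_trans h2 _; rewrite ler_pM ?exprn_ge0.
- by apply: ler_pM => //; exact: le_trans s2.
- by apply: ler_pM => //; apply: le_trans h4 _; rewrite lerMn2r.
- by apply: ler_pM => //; apply: le_trans h1 _; rewrite ler_pM.
Qed.

Definition twopii : C := Complex 0 (pi *+ 2).

Lemma cexp_twopii : cexp twopii = 1.
Proof. by rewrite /cexp/= expR0 cos2pi sin2pi !mul1r. Qed.

Lemma cexpMz z (k : int) : cexp (z * k%:~R) = cexp z ^ k.
Proof.
have nat_case n : cexp (z * n%:R) = cexp z ^+ n.
  elim: n => [|n IH]; first by rewrite mulr0 cexp0.
  by rewrite -natr1 mulrDr mulr1 cexpD IH exprSr.
case: k => n; first by rewrite -pmulrn nat_case.
by rewrite NegzE mulrNz mulrN cexpN -pmulrn nat_case -exprnN.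
Qed.

Lemma cexp_eq1 z : cexp z = 1 <-> exists k : int, z = twopii * k%:~R.
Proof.
split=> [|[k ->]]; last by rewrite cexpMz cexp_twopii exp1rz.
case: z => a b h.
have := normc_cexp (Complex a b : C); rewrite h normc1/= => /esym a0.
have {}a0 : a = 0 by apply: expR_inj; rewrite expR0.
move: h; rewrite /cexp/= a0 expR0 !mul1r => -[/cos_eq1[k ->] _].
exists k; have -> : (k%:~R : C) = Complex k%:~R 0 by rewrite -(rmorph_int (real_complex R)).
rewrite /twopii; apply/eqP; rewrite eq_complex/=.
by apply/andP; split; apply/eqP; ring.
Qed.

(** * Fourier series with rapidly decreasing coefficients *)

(** Coefficients that decrease faster than any geometric sequence: the Fourier
    series then converges absolutely on the whole line, and this class is stable
    under multiplication by n. *)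
Definition rapid (a : int -> C) := forall rho : R, exists M : R,
  forall A : {fset int},
    \sum_(n <- A) normc (a n) * expR (rho * (absz n)%:R) <= M.

Lemma rapid_dom (a b : int -> C) (K kappa : R) :
  rapid a ->
  (forall n, normc (b n) <= K * normc (a n) * expR (kappa * (absz n)%:R)) ->
  rapid b.
Proof.
move=> ra ba rho; have [M hM] := ra (rho + kappa).
exists (`|K| * M) => A.
apply: (@le_trans _ _ (\sum_(n <- A) `|K| * (normc (a n) * expR ((rho + kappa) * (absz n)%:R)))).
  apply: ler_sum => n _; rewrite mulrDl expRD.
  rewrite [leRHS](_ : _ = `|K| * normc (a n) * expR (kappa * `|n|%:R) * expR (rho * `|n|%:R)); last by ring.
  rewrite ler_wpM2r ?expR_ge0//; apply: le_trans (ba n) _.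
  by rewrite ler_wpM2r ?expR_ge0// ler_wpM2r ?normc_ge0// ler_norm.
by rewrite -mulr_sumr ler_wpM2l.
Qed.

Lemma sum_geo (r : R) n : 0 <= r <= 2^-1 -> \sum_(i < n) r ^+ i <= 2.
Proof.
move=> /andP[r0 r1].
apply: (@le_trans _ _ (2 - 2 * 2^-1 ^+ n)); last first.
  by rewrite gerBl mulr_ge0// exprn_ge0// invr_ge0.
elim: n => [|n IH]; first by rewrite big_ord0 expr0 mulr1 subrr.
rewrite big_ord_recr/=; apply: (le_trans (lerD IH (lexx _))).
have : r ^+ n <= 2^-1 ^+ n by rewrite lerXn2r ?nnegrE ?invr_ge0.
by rewrite exprS; lra.
Qed.

Lemma sum_int_le (f : int -> R) (M N : R) (A : {fset int}) :
  (forall n, 0 <= f n) ->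
  (forall k, \sum_(i < k) f (Posz i) <= M) ->
  (forall k, \sum_(i < k) f (Negz i) <= N) ->
  \sum_(n <- A) f n <= M + N.
Proof.
move=> f0 fM fN.
have [k hk] : exists k, forall n, n \in A -> (absz n < k)%N.
  by exists (\max_(n <- A) absz n).+1 => n nA; rewrite ltnS leq_bigmax_seq.
pose s := map Posz (iota 0 k) ++ map Negz (iota 0 k).
apply: (@le_trans _ _ (\sum_(n <- seq_fset tt s) f n)).
  apply: ler_sum_fset => //; apply/fsubsetP => n nA.
  have nN := hk n nA.
  rewrite seq_fsetE mem_cat; case: n nA nN => n _ nN; apply/orP; [left|right].
    by rewrite mem_map ?mem_iota// => ? ? [].
  by rewrite mem_map ?mem_iota ?(ltnW nN)// => ? ? [].
rewrite (perm_big s); last first.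
  apply: uniq_perm; [exact: seq_fset_uniq| |exact: seq_fsetE].
  rewrite /s cat_uniq !map_inj_uniq ?iota_uniq ?andbT; try by move=> ? ? [].
   by apply/hasPn => _ /mapP[i _ ->]; apply/mapP => -[].
rewrite /s big_cat !big_map/=; apply: lerD.
  by rewrite -[k]subn0 big_mkord.
by rewrite -[k]subn0 big_mkord.
Qed.

(** Complete the square: kappa |n| - delta |n|^2 + rho |n| is at most a constant
    minus |n|, so that the weighted coefficients are dominated by two geometric
    series. *)
Lemma rapid_gauss (a : int -> C) (K delta kappa : R) : 0 < delta ->
  (forall n, normc (a n) <= K * expR (kappa * (absz n)%:R - delta * (absz n)%:R ^+ 2)) ->
  rapid a.
Proof.
move=> d0 ha rho.
pose c := rho + kappa + 1.
pose K' := `|K| * expR (c ^+ 2 / (4 * delta)).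
exists (K' * 4) => A.
apply: (@le_trans _ _ (\sum_(n <- A) K' * expR (- 1) ^+ (absz n))).
  apply: ler_sum => n _; rewrite -expRM_natl.
  apply: (@le_trans _ _ (`|K| * expR (kappa * `|n|%:R - delta * `|n|%:R ^+ 2) * expR (rho * `|n|%:R))).
    rewrite ler_wpM2r ?expR_ge0//; apply: le_trans (ha n) _.
    by rewrite ler_wpM2r ?expR_ge0// ler_norm.
  rewrite /K' -!mulrA -!expRD ler_wpM2l// ler_expR.
  set x := (absz n)%:R.
  rewrite -subr_ge0.
  have -> : c * (c / (4 * delta)) + x * -1 - (kappa * x - delta * x ^+ 2 + rho * x)
     = delta * (x - c / (2 * delta)) ^+ 2.
    by rewrite /c; field; rewrite gt_eqF.
  by rewrite mulr_ge0 ?sqr_ge0 ?ltW.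
rewrite -mulr_sumr ler_wpM2l ?mulr_ge0 ?expR_ge0//.
have -> : 4 = 2 + 2 :> R by lra.
have e1 : 0 <= (expR (- 1) : R) <= 2^-1.
  rewrite expR_ge0/= expRN lef_pV2 ?posrE ?expR_gt0//.
  by apply: le_trans (expR_ge1Dx _).
apply: (@sum_int_le (fun n => expR (-1) ^+ absz n)) => n /=.
- by rewrite exprn_ge0 ?expR_ge0.
- exact: sum_geo.
- by apply: le_trans (sum_geo n.+1 e1); rewrite big_ord_recl/= lerDr.
Qed.

Definition laurent_term (a : int -> C) (z : C) (n : int) : C := a n * cexp (n%:~R * z).

Lemma normc_int (n : int) : normc (n%:~R : C) = (absz n)%:R.
Proof.
rewrite -(rmorph_int (real_complex R)) /= expr0n/= addr0 sqrtr_sqr.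
by rewrite -intr_norm pmulrn abszE.
Qed.

Lemma normc_laurent_term a z n (r : R) : normc z <= r ->
  normc (laurent_term a z n) <= normc (a n) * expR (r * (absz n)%:R).
Proof.
move=> zr; rewrite normcM normc_cexp ler_wpM2l ?normc_ge0// ler_expR.
apply: le_trans (ler_norm _) _; apply: le_trans (normr_Re_le _) _.
by rewrite normcM normc_int mulrC ler_wpM2r.
Qed.

Lemma summable_laurent_term a z : rapid a -> summable (laurent_term a z).
Proof.
move=> ra; have [M hM] := ra (normc z); exists M => A.
by apply: le_trans (hM A); apply: ler_sum => n _; exact: normc_laurent_term.
Qed.

Definition laurent (a : int -> C) (z : C) : C := xget 0 (has_sum (laurent_term a z)).

Lemma has_sum_laurent a z : rapid a -> has_sum (laurent_term a z) (laurent a z).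
Proof.
move=> /(@summable_laurent_term a z)/summable_has_sum[s hs].
exact: xgetI hs.
Qed.

Arguments has_sum_laurent {a} z _.

Lemma laurentE a z s : has_sum (laurent_term a z) s -> laurent a z = s.
Proof.
by move=> h; apply: has_sum_unique (h); exact: xgetI h.
Qed.

Definition deriv_coef (a : int -> C) (n : int) : C := n%:~R * a n.

Lemma rapid_deriv_coef a : rapid a -> rapid (deriv_coef a).
Proof.
move=> ra; apply: (rapid_dom (K := 1) (kappa := 1) ra) => n.
rewrite /deriv_coef normcM normc_int !mul1r mulrC ler_wpM2l ?normc_ge0//.
by apply: le_trans (expR_ge1Dx _); rewrite lerDr.
Qed.

(** Termwise second order expansion.  The remainder of e^(n h) is at most
    5 |n h|^2 e^|n h|, and n^2 e^|n h| <= e^(3 |n|) for |h| <= 1: three units more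
    in the exponential weight absorb it. *)
Lemma laurent_expand a z : rapid a -> exists K : R, forall h : C,
  normc h <= 1 ->
  normc (laurent a (z + h) - laurent a z - h * laurent (deriv_coef a) z) <=
    K * normc h ^+ 2.
Proof.
move=> ra; have [M hM] := ra (normc z + 1 + 1 + 1).
exists (5 * M) => h h1.
have s1 := has_sum_laurent (z + h) ra.
have s2 := has_sum_laurent z ra.
have s3 := has_sum_laurent z (rapid_deriv_coef ra).
have := has_sumB (has_sumB s1 s2) (has_sumMl h s3).
move/has_sum_normc; apply => A.
apply: (@le_trans _ _ (\sum_(n <- A) 5 * normc h ^+ 2 *
    (normc (a n) * expR ((normc z + 1 + 1 + 1) * `|n|%:R)))); last first.
  by rewrite -mulr_sumr mulrAC ler_wpM2r ?exprn_ge0 ?normc_ge0// ler_wpM2l.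
apply: ler_sum => n _.
rewrite (_ : _ - _ = laurent_term a z n * (cexp (n%:~R * h) - 1 - n%:~R * h)); last first.
  by rewrite /laurent_term /deriv_coef mulrDr cexpD; ring.
rewrite normcM.
apply: le_trans (ler_pM (normc_ge0 _) (normc_ge0 _) (normc_laurent_term _ _ (lexx _)) (normc_cexp_sub1x _)) _.
rewrite normcM normc_int exprMn; set x := `|n|%:R.
have -> : (normc z + 1 + 1 + 1) * x = normc z * x + x + x + x by ring.
rewrite !expRD; have x0 : 0 <= x by [].
have xe : x <= expR x by apply: le_trans (expR_ge1Dx _); rewrite lerDr.
have xhe : expR (x * normc h) <= expR x by rewrite ler_expR ler_piMr.
rewrite [leRHS](_ : _ = (normc (a n) * expR (normc z * x)) * (5 * (expR x ^+ 2 * normc h ^+ 2) * expR x)); last by ring.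
have [a0 h0] : 0 <= normc (a n) /\ 0 <= normc h by split; exact: normc_ge0.
rewrite ler_wpM2l ?mulr_ge0 ?expR_ge0// ler_pM ?mulr_ge0 ?exprn_ge0 ?expR_ge0//.
by rewrite ler_wpM2l// ler_wpM2r ?exprn_ge0// ler_sqr ?nnegrE ?expR_ge0.
Qed.

Lemma is_derive_cvg (f : C -> C) (z d : C) :
  h^-1 *: ((f \o shift z) (h *: (1 : C)) - f z) @[h --> (0 : C)^'] --> d ->
  is_derive z (1 : C) f d.
Proof.
move=> h; apply: DeriveDef; first by apply/cvg_ex; exists d.
by apply/cvg_lim => //; exact: norm_hausdorff.
Qed.

Lemma expand_is_derive (f : C -> C) (z d : C) (K : R) :
  (forall h : C, normc h <= 1 -> normc (f (z + h) - f z - h * d) <= K * normc h ^+ 2) ->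
  is_derive z (1 : C) f d.
Proof.
move=> fK; apply: is_derive_cvg; apply/cvgrPdist_le => -[e e'].
rewrite ltcE/= => /andP[/eqP -> e0].
pose r := Num.min 1 (e / (`|K| + 1)).
have K0 : 0 < `|K| + 1 by rewrite ltr_wpDl.
have r0 : 0 < (real_complex R r : C) by rewrite ltcR lt_min ltr01 divr_gt0.
near=> h.
have h0 : h != 0 by near: h; exact: (@nbhs_dnbhs_neq C 0).
have : normc h < r by rewrite -ltcR; near: h; exact: (@dnbhs0_lt _ C _ r0).
rewrite lt_min => /andP[h1 he].
have nh0 : 0 < normc h by rewrite lt_def normc_ge0 andbT; apply: contra h0 => /eqP/eq0_normc ->.
rewrite distrC /= -[_ *: _]/(h^-1 * _) -[h *: 1]/(h * 1) mulr1 addrC.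
have -> : - d + h^-1 * (f (h + z) - f z) = h^-1 * (f (z + h) - f z - h * d).
  by rewrite (addrC h z); field.
suff : normc (h^-1 * (f (z + h) - f z - h * d)) <= e by rewrite -lecR.
rewrite normcM normcV ler_pdivrMl//.
apply: le_trans (fK _ (ltW h1)) _.
rewrite mulrC expr2 -mulrA ler_wpM2l ?normc_ge0//.
move: he; rewrite ltr_pdivlMr// => he; apply: le_trans (ltW he).
by rewrite ler_wpM2l ?normc_ge0// (le_trans (ler_norm _))// lerDl.
Unshelve. all: by end_near.
Qed.

Lemma is_derive_laurent a z : rapid a ->
  is_derive z (1 : C) (laurent a) (laurent (deriv_coef a) z).
Proof. by move=> /laurent_expand-/(_ z)[K]; exact: expand_is_derive. Qed.

(** * Theta functions *)

(** The nome is e^ell.  A very negative period makes it so small that the series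
    of theta is dominated by its two main terms. *)
Definition ell : C := - 8%:R.

(** The powers of e^(ell / 4): with integral exponents, all the coefficients
    below are such powers up to sign. *)
Definition qpow (k : int) : C := cexp ((- 2 * k)%:~R).

Lemma qpowD k l : qpow (k + l) = qpow k * qpow l.
Proof. by rewrite /qpow mulrDr intrD cexpD. Qed.

Lemma Re_int (k : int) : Re (k%:~R : C) = k%:~R.
Proof. by rewrite -(rmorph_int (real_complex R)). Qed.

Lemma normc_qpow k : normc (qpow k) = expR (- 2 * k%:~R).
Proof. by rewrite normc_cexp Re_int intrM. Qed.

Lemma cexp_ell (n : int) : cexp (n%:~R * ell) = qpow (4 * n).
Proof. by rewrite /qpow /ell; congr cexp; rewrite !intrM; ring. Qed.

Lemma absz_intr (n : int) : (absz n)%:R = `|n%:~R| :> R.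
Proof. by rewrite -intr_norm -abszE pmulrn. Qed.

Lemma has_sum_shift (u : int -> C) (s : C) (k : int) :
  has_sum (fun n => u (n + k)) s -> has_sum u s.
Proof.
apply: (has_sum_reindex (phi := fun n => n + k)); first exact: addIr.
by move=> n []; exists (n - k); rewrite ?subrK.
Qed.

Lemma laurentD2pi (a : int -> C) z : laurent a (z + twopii) = laurent a z.
Proof.
rewrite /laurent; congr (xget _ (has_sum _)); apply/funext => n.
rewrite /laurent_term mulrDr cexpD [_ * twopii]mulrC.
by rewrite (_ : cexp (twopii * _) = 1) ?mulr1//; apply/cexp_eq1; exists n.
Qed.

(** Quasi-periodicity along [ell] is a recursion on the coefficients, since
    e^(n ell) = qpow (4 * n). *)
Lemma laurent_qshift (a : int -> C) (k : int) (c : C) z : rapid a -> c != 0 ->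
  (forall n, a (n + k) = c * qpow (4 * n) * a n) ->
  laurent a (z + ell) = c^-1 * cexp (- (k%:~R * z)) * laurent a z.
Proof.
move=> ra c0 ha; apply: laurentE.
have h := has_sum_laurent z ra.
have {}h : has_sum (fun n => laurent_term a z (n + k)) (laurent a z).
  apply: (@has_sum_shift _ _ (- k)).
  by under eq_fun do rewrite subrK.
rewrite (_ : laurent_term a (z + ell) =
  fun n => c^-1 * cexp (- (k%:~R * z)) * laurent_term a z (n + k)); first exact: has_sumMl.
apply/funext => n; rewrite /laurent_term ha intrD [_ * (z + _)]mulrDr [(_ + k%:~R) * z]mulrDl !cexpD cexp_ell cexpN.
by field; rewrite c0 cexp_neq0.
Qed.

Definition alt (n : int) : C := (-1) ^ n.

Lemma altD m n : alt (m + n) = alt m * alt n.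
Proof. by rewrite /alt expfzDr// oppr_eq0 oner_eq0. Qed.

Lemma alt1 : alt 1 = -1.
Proof. by []. Qed.

Lemma alt_sqr n : alt n * alt n = 1.
Proof.
rewrite -altD /alt (_ : n + n = 2 * n); last by rewrite mulr_natl mulr2n.
by rewrite -exprz_exp (_ : (-1) ^ 2 = 1 :> C) ?exp1rz// -exprnP sqrrN expr1n.
Qed.

Lemma int_parity (k : int) : (exists m, k = m + m) \/ (exists m, k = m + m + 1).
Proof.
case: k => n.
  have := odd_double_half n; case: (odd n) => /= h; [right|left]; exists n./2%:Z; lia.
have := odd_double_half n; case: (odd n) => /= h; [left|right]; exists (- (n./2%:Z) - 1); lia.
Qed.

(** The pairs (m + n, m - n + 1) are those whose entries have different
    parities; the other pairs have an even sum. *)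
Lemma int_pair_parity (N M : int) :
  (exists m n, N = m + n /\ M = m - n + 1) \/ (exists k, N + M = k + k).
Proof.
have [[m e]|[m e]] := int_parity (N + M - 1).
  by left; exists m, (N - m); split; lia.
by right; exists (m + 1); lia.
Qed.

Lemma alt_cases k : alt k = 1 \/ alt k = -1.
Proof.
have [[m ->]|[m ->]] := int_parity k; first by left; rewrite altD alt_sqr.
by right; rewrite !altD alt_sqr alt1 mul1r.
Qed.

(** The series with the coefficients [qpow (n * (n - 2))] satisfies
    f(z + ell) = e^(- 2 z) f(z).  Its parts of even index [i = false] and of odd
    index [i = true] span the Fourier series that solve this equation. *)
Definition theta2_coef (i : bool) (n : int) : C :=
  (1 + (-1) ^+ i * alt n) / 2 * qpow (n * (n - 2)).
(** The odd Jacobi theta function times an exponential factor, which makes it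
    periodic along 2 pi i. *)
Definition theta_coef (n : int) : C := alt n * qpow (2 * n * (n - 1)).

Lemma altN n : alt (- n) = alt n.
Proof.
by rewrite -[LHS]mulr1 -(alt_sqr n) mulrA -altD addNr mul1r.
Qed.

Lemma normc_alt n : normc (alt n) = 1.
Proof. by have [->|->] := alt_cases n; rewrite ?normcN normc1. Qed.

Lemma rapid_theta2_coef i : rapid (theta2_coef i).
Proof.
apply: (@rapid_gauss _ 1 2 4) => // n.
rewrite normcM mul1r normc_qpow.
have h : normc ((1 + (-1) ^+ i * alt n) / 2) <= 1.
  have [->|->] := alt_cases n; case: i;
    rewrite ?expr0 ?expr1 ?mulN1r ?mul1r ?opprK ?subrr ?mul0r ?normc0//;
    by rewrite (_ : (1 + 1) / 2 = 1 :> C) ?normc1//; field.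
rewrite -[leRHS]mul1r ler_pM ?normc_ge0 ?expR_ge0// ler_expR.
rewrite intrM intrB absz_intr real_normK ?num_real//.
by have := ler_norm (n%:~R : R); lra.
Qed.

Lemma rapid_theta_coef : rapid theta_coef.
Proof.
apply: (@rapid_gauss _ 1 4 4) => // n.
rewrite normcM normc_alt !mul1r normc_qpow ler_expR.
rewrite !intrM intrB absz_intr real_normK ?num_real//.
by have := ler_norm (n%:~R : R); lra.
Qed.

Definition theta2 (i : bool) := laurent (theta2_coef i).
Definition theta := laurent theta_coef.

Lemma theta2Dell i z : theta2 i (z + ell) = cexp (- (2 * z)) * theta2 i z.
Proof.
rewrite /theta2 (@laurent_qshift _ 2 1) ?oner_eq0 ?invr1 ?mul1r//.
  exact: rapid_theta2_coef.
move=> n; rewrite /theta2_coef altD (_ : alt 2 = 1) ?mulr1; last by rewrite -(alt_sqr 1).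
rewrite (_ : (n + 2) * (n + 2 - 2) = 4 * n + n * (n - 2)); last by ring.
by rewrite qpowD; ring.
Qed.

Lemma thetaDell z : theta (z + ell) = - cexp (- z) * theta z.
Proof.
rewrite /theta (@laurent_qshift _ 1 (-1)) ?oppr_eq0 ?oner_eq0 ?invrN1 ?mul1r ?mulN1r//.
  exact: rapid_theta_coef.
move=> n; rewrite /theta_coef altD alt1.
rewrite (_ : 2 * (n + 1) * (n + 1 - 1) = 4 * n + 2 * n * (n - 1)); last by ring.
by rewrite qpowD; ring.
Qed.

(** The product on the left is a double series over (m, n).  In the indices
    N = m + n and M = m - n + 1, the exponents of the nome and of e^x, e^a
    separate, because (m^2 - m) + (n^2 - n) is half of
    (N^2 - 2 N + M^2 - 2 M + 1).  The pairs (N, M) that occur are those of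
    different parities, which the difference on the right selects, with the
    sign (-1)^N. *)
Lemma theta_split x a :
  theta (x + a) * theta (x - a) =
  qpow 1 * cexp (- a) * (theta2 false x * theta2 true a - theta2 true x * theta2 false a).
Proof.
have sum1 := has_sumM (summable_laurent_term (x + a) rapid_theta_coef) (summable_laurent_term (x - a) rapid_theta_coef)
  (has_sum_laurent (x + a) rapid_theta_coef) (has_sum_laurent (x - a) rapid_theta_coef).
have sum2 i j := has_sumM (summable_laurent_term x (rapid_theta2_coef i)) (summable_laurent_term a (rapid_theta2_coef j))
  (has_sum_laurent x (rapid_theta2_coef i)) (has_sum_laurent a (rapid_theta2_coef j)).
have sum3 := has_sumMl (qpow 1 * cexp (- a)) (has_sumB (sum2 false true) (sum2 true false)).
apply: (has_sum_unique _ sum3).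
pose phi (p : int * int) := (p.1 + p.2, p.1 - p.2 + 1).
apply: (@has_sum_reindex _ _ _ phi) => [[m n] [m' n'] [] | [N M] h|].
- by rewrite /= => e1 e2; congr pair; lia.
(* Outside the image, N and M have the same parity and the terms cancel. *)
- have sgNM : alt N = alt M.
    have [[m [n [eN eM]]]|[k e]] := int_pair_parity N M.
      by case: h; exists (m, n); rewrite // eN eM.
    have : alt N * alt M = 1 by rewrite -altD e altD alt_sqr.
    by move=> h1; rewrite -[LHS]mulr1 -(alt_sqr M) mulrA h1 mul1r.
  rewrite /laurent_term /theta2_coef /= sgNM; ring.
apply: eq_has_sum sum1 => -[m n].
symmetry; rewrite /phi /laurent_term /theta2_coef /theta_coef /=.
have -> : alt (m - n + 1) = - (alt m * alt n).
  by rewrite !altD altN alt1 mulrN1.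
rewrite altD.
have qE : qpow 1 * qpow ((m + n) * (m + n - 2)) *
    qpow ((m - n + 1) * (m - n + 1 - 2)) =
    qpow (2 * m * (m - 1)) * qpow (2 * n * (n - 1)).
  by rewrite -!qpowD; congr qpow; ring.
have eE : cexp (- a) * cexp ((m + n)%:~R * x) * cexp ((m - n + 1)%:~R * a) =
    cexp (m%:~R * (x + a)) * cexp (n%:~R * (x - a)).
  by rewrite -!cexpD; congr cexp; rewrite !intrD intrN; ring.
transitivity (alt m * alt n * (qpow 1 * qpow ((m + n) * (m + n - 2)) * qpow ((m - n + 1) * (m - n + 1 - 2))) *
  (cexp (- a) * cexp ((m + n)%:~R * x) * cexp ((m - n + 1)%:~R * a))); last first.
  by rewrite qE eE; ring.
by field.
Qed.

Definition Lam (z : C) : Prop := exists m n : int, z = twopii * m%:~R + ell * n%:~R.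

(** With w = e^z, the bracket w^(m+1) - w^(-m) is w - 1 times the sum of the w^j
    for - m <= j <= m, and each |w^j| is at most e^(4 m). *)
Lemma geom_bracket z m : `|Re z| <= 4 -> exists2 S : C,
  cexp (m.+1%:R * z) - cexp (- m%:R * z) = (cexp z - 1) * S &
  normc S <= (2 * m + 1)%:R * expR (4 * m%:R).
Proof.
move=> zr; elim: m => [|m [S hS nS]].
  exists 1; first by rewrite mul1r oppr0 mul0r cexp0 mulr1.
  by rewrite normc1 mulr0 expR0 muln0 add0n mulr1.
have bnd (k : int) : absz k = m.+1 -> normc (cexp (k%:~R * z)) <= expR (4 * m.+1%:R).
  move=> ek; rewrite normc_cexp ler_expR.
  have -> : Re (k%:~R * z) = k%:~R * Re z.
    by rewrite -(rmorph_int (real_complex R)); case: (z) => ? ? /=; rewrite mul0r subr0.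
  apply: le_trans (ler_norm _) _; rewrite normrM -absz_intr ek mulrC.
  by rewrite ler_wpM2r.
exists (S + (cexp (m.+1%:R * z) + cexp (- m.+1%:R * z))).
  rewrite mulrDr -hS; have -> : m.+2%:R * z = m.+1%:R * z + z.
    by rewrite -natr1 mulrDl mul1r.
  have -> : - m%:R * z = - m.+1%:R * z + z.
    by rewrite -[m.+1%:R in RHS]natr1; ring.
  rewrite !cexpD; ring.
apply: le_trans (le_normcD _ _) _.
apply: (@le_trans _ _ ((2 * m + 1)%:R * expR (4 * m.+1%:R) + (expR (4 * m.+1%:R) + expR (4 * m.+1%:R)))).
  apply: lerD.
    by apply: le_trans nS _; rewrite ler_wpM2l// ler_expR ler_wpM2l// ler_nat.
  apply: le_trans (le_normcD _ _) _; apply: lerD; first by rewrite pmulrn; exact: bnd.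
  by rewrite pmulrn -mulrNz; apply: bnd; rewrite abszN.
rewrite (_ : (2 * m.+1 + 1)%N = (2 * m + 1 + 1 + 1)%N); last by lia.
by rewrite !natrD !mulrDl !mul1r addrA lexx.
Qed.

(** The terms n and 1 - n of theta have opposite coefficients: their sum is
    divisible by 1 - e^z.  This accounts for the zero of theta at the origin, and
    makes the estimate of the other terms relative to 1 - e^z. *)
Definition theta_pair z (n : int) : C := laurent_term theta_coef z n + laurent_term theta_coef z (1 - n).

Lemma theta_pairC z n : theta_pair z (1 - n) = theta_pair z n.
Proof. by rewrite /theta_pair subKr addrC. Qed.

Lemma theta_pair1 z : theta_pair z 1 = 1 - cexp z.
Proof.
have q0 : qpow 0 = 1 by rewrite /qpow mulr0 mulr0z cexp0.
rewrite /theta_pair /laurent_term /theta_coef !subrr !mulr0 mul0r q0 alt1 mulr0z mul0r cexp0.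
by rewrite (_ : alt 0 = 1)// !mulr1 mulr1z mul1r mulN1r addrC.
Qed.

(** The coefficient of the pair is e^(- 4 m (m + 1)) and the bracket is at most
    (2 m + 1) e^(4 m).  Then use 2 m + 1 <= 3^m and e^(- 4) <= 1 / 16. *)
Lemma normc_theta_pair z m : `|Re z| <= 4 ->
  normc (theta_pair z m.+1) <= normc (1 - cexp z) * (3 / 16) ^+ m.
Proof.
move=> zr; have [S hS nS] := geom_bracket m zr.
have -> : theta_pair z m.+1 = alt m.+1 * qpow (2 * m.+1%:Z * m%:Z) * ((cexp z - 1) * S).
  rewrite -hS !pmulrn /theta_pair /laurent_term /theta_coef.
  have -> : 1 - m.+1%:Z = - m%:Z by lia.
  have -> : m.+1%:Z - 1 = m by lia.
  have -> : 2 * - m%:Z * (- m%:Z - 1) = 2 * m.+1%:Z * m%:Z.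
    by rewrite intS; ring.
  have -> : alt (- m%:Z) = - alt m.+1.
    by rewrite altN intS altD alt1 mulN1r opprK.
  by rewrite mulrNz; ring.
rewrite !normcM normc_alt mul1r normc_qpow -[in leRHS]normcN opprB.
rewrite mulrCA ler_wpM2l ?normc_ge0//.
apply: le_trans (ler_wpM2l (expR_ge0 _) nS) _.
rewrite mulrCA -expRD.
have n3 : (2 * m + 1)%:R <= (3 : R) ^+ m.
  rewrite -natrX ler_nat; elim: (m) => // k; rewrite expnS; lia.
have e16 : expR (- 2 * (2 * m.+1%:Z * m%:Z)%:~R + 4 * m%:R) <= (16^-1 : R) ^+ m.
  apply: (@le_trans _ _ (expR (- 4) ^+ m)).
    rewrite -expRM_natl ler_expR -natr1 !intrM -!pmulrn -natr1.
    have : (m%:R : R) <= m%:R * m%:R by rewrite -natrM ler_nat; nia.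
    lra.
  rewrite lerXn2r ?nnegrE ?expR_ge0 ?invr_ge0//.
  rewrite expRN lef_pV2 ?posrE ?expR_gt0//.
  have -> : 4 = 4%:R * 1 :> R by rewrite mulr1.
  rewrite expRM_natl (_ : 16 = 2 ^+ 4); last by lra.
  by rewrite lerXn2r ?nnegrE ?expR_ge0// (le_trans _ (expR_ge1Dx _)).
by rewrite exprMn ler_pM ?expR_ge0.
Qed.

(** Reindexing by n |-> 1 - n shows that 2 theta(z) is the sum of all the pairs.
    The pairs n = 0 and n = 1 give 2 (1 - e^z); the other ones are dominated by
    two geometric series of ratio 3 / 16. *)
Lemma theta_estimate z : `|Re z| <= 4 ->
  normc (theta z - (1 - cexp z)) <= 2^-1 * normc (1 - cexp z).
Proof.
move=> zr.
have h1 := has_sum_laurent z rapid_theta_coef; rewrite -/theta in h1.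
have h2 : has_sum (fun n => laurent_term theta_coef z (1 - n)) (theta z).
  apply: (@has_sum_reindex _ _ _ (fun n => 1 - n)) => [m n /=|n []|]; first by lia.
    by exists (1 - n) => //; lia.
  by apply: cvg_trans h1; rewrite /has_sum; under eq_fun do under eq_bigr do rewrite /= subKr.
(* [v] is the main part: the pairs n = 0 and n = 1. *)
pose v (n : int) : C := if (n == 0) || (n == 1) then 1 - cexp z else 0.
have h3 : has_sum v ((1 - cexp z) *+ 2).
  rewrite (_ : _ *+ 2 = \sum_(n <- [fset 0; 1]%fset) v n).
    by apply: has_sum_fin => n; rewrite !inE /v => /negbTE ->.
  by rewrite big_fsetU1 ?inE// big_seq_fset1 mulr2n.
have [g gE] : exists g, normc (1 - cexp z) = g by eexists.
have g0 : 0 <= g by rewrite -gE normc_ge0.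
have -> : normc (theta z - (1 - cexp z)) = 2^-1 * normc (theta z + theta z - (1 - cexp z) *+ 2).
  rewrite -[_ + _ - _](_ : (theta z - (1 - cexp z)) *+ 2 = _); last by rewrite mulrnBl mulr2n.
  by rewrite normcMn; lra.
rewrite gE ler_wpM2l ?invr_ge0//.
apply: (@le_trans _ _ (2^-1 * g + 2^-1 * g)); last by lra.
apply: (has_sum_normc (has_sumB (has_sumD h1 h2) h3)) => A.
pose G m := if m is 0%N then 0 else g * (3 / 16) ^+ m : R.
have GM k : \sum_(i < k) G i <= 2^-1 * g.
  case: k => [|k]; first by rewrite big_ord0 mulr_ge0 ?invr_ge0.
  rewrite big_ord_recl/= add0r.
  under eq_bigr do rewrite exprS mulrCA.
  rewrite -mulr_sumr -mulr_sumr.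
  have := ler_wpM2l g0 (@sum_geo (3 / 16) k _); set s := \sum_(i < k) _.
  by move=> /(_ ltac:(apply/andP; split; lra)); lra.
have v2 k : normc (theta_pair z k.+2%:Z - v k.+2%:Z) <= G k.+1.
  by rewrite /v/= subr0 -gE; exact: normc_theta_pair.
apply: (@sum_int_le (fun n => normc (theta_pair z n - v n))) => [n|k|k].
- exact: normc_ge0.
- case: k => [|k]; first by rewrite big_ord0 (le_trans _ (GM 0%N))// big_ord0.
  have t0 : theta_pair z 0 = 1 - cexp z := etrans (theta_pairC z 1) (theta_pair1 z).
  have n0 : normc (theta_pair z 0 - v 0) = 0 by rewrite t0 /v eqxx subrr normc0.
  rewrite big_ord_recl [X in X + _]n0 add0r.
  apply: le_trans (GM k); apply: ler_sum => -[[|i] ik] _; last exact: v2.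
  rewrite [X in X <= _](_ : _ = normc (theta_pair z 1 - v 1))//.
  by rewrite theta_pair1 subrr normc0.
- apply: le_trans (GM k.+1); rewrite big_ord_recl/= add0r.
  apply: ler_sum => i _; rewrite -theta_pairC (_ : 1 - Negz i = i.+2); last by lia.
  exact: v2.
Qed.

Lemma theta_shift0 z (n : int) : theta (z + ell * n%:~R) = 0 -> theta z = 0.
Proof.
have nat_case y k : theta (y + ell * k%:R) = 0 <-> theta y = 0.
  elim: k => [|k <-]; first by rewrite mulr0 addr0.
  rewrite -natr1 mulrDr mulr1 addrA thetaDell; split=> [/eqP|->]; last by rewrite mulr0.
  by rewrite mulf_eq0 oppr_eq0 (negbTE (cexp_neq0 _)) => /eqP.
case: n => n; first by rewrite -pmulrn => /nat_case.
rewrite NegzE mulrNz -pmulrn mulrN => h.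
by rewrite -(subrK (ell * n.+1%:R) z); apply/nat_case.
Qed.

(** Quasi-periodicity moves z to the strip |Re z| <= 4, where the estimate leaves
    e^z = 1 only. *)
Lemma theta_zero z : theta z = 0 -> Lam z.
Proof.
(* z - ell * n then has its real part in [-4, 4). *)
pose n := - Num.floor ((Re z + 4) / 8).
have /andP[n1 n2] := mem_rg1_floor ((Re z + 4) / 8).
rewrite -{1}(subrK (ell * n%:~R) z) => /theta_shift0; set y := z - _ => y0.
have : `|Re y| <= 4.
  have -> : Re y = Re z + 8 * n%:~R.
    rewrite /y (_ : ell * n%:~R = - (8 * n)%:~R); last by rewrite /ell intrM mulNr.
    rewrite opprK -(rmorph_int (real_complex R)) intrM; by case: (z).
  rewrite ler_norml /n mulrNz; move: n1 n2; rewrite ler_pdivlMr// ltr_pdivrMr//.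
  by set k := (Num.floor _)%:~R => ? ?; apply/andP; split; lra.
move=> /theta_estimate; rewrite y0 sub0r normcN => h.
have : normc (1 - cexp y) = 0 by have := normc_ge0 (1 - cexp y); lra.
move=> /eq0_normc/eqP; rewrite subr_eq0 eq_sym => /eqP/cexp_eq1[m ym].
by exists m, n; rewrite -ym subrK.
Qed.

(** * The map of degree two from the elliptic curve to the line *)

Lemma Lam_add z w : Lam z -> Lam w -> Lam (z + w).
Proof.
move=> [m [n ->]] [m' [n' ->]]; exists (m + m'), (n + n').
by rewrite !intrD; ring.
Qed.

Lemma Lam_opp z : Lam z -> Lam (- z).
Proof.
by move=> [m [n ->]]; exists (- m), (- n); rewrite !mulrNz; ring.
Qed.

Lemma Lam_Re z : Lam z -> exists n : int, Re z = - 8 * n%:~R.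
Proof.
move=> [m [n ->]]; exists n.
rewrite -!(rmorph_int (real_complex R)) /twopii /ell.
by rewrite -(rmorph_nat (real_complex R)) -rmorphN /=; ring.
Qed.

Lemma not_Lam_int (k : int) : ~~ (8 %| `|k|)%N -> ~ Lam k%:~R.
Proof.
move=> k8 /Lam_Re[n]; rewrite Re_int => e.
have : k = - 8 * n by apply/eqP; rewrite -(eqr_int R) e intrM.
by move=> kn; move: k8; rewrite kn abszM dvdn_mulr.
Qed.

Lemma theta2_quasiperiodic (lam : C) : Lam lam -> forall z, exists2 c : C, c != 0 &
  forall i, theta2 i (z + lam) = c * theta2 i z.
Proof.
move=> [m [n ->]].
have tpi_int i z : theta2 i (z + twopii * m%:~R) = theta2 i z.
  have nat_case k y : theta2 i (y + twopii * k%:R) = theta2 i y.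
    elim: k => [|k <-]; first by rewrite mulr0 addr0.
    by rewrite -natr1 mulrDr mulr1 addrA /theta2 laurentD2pi.
  case: (m) => k; first by rewrite -pmulrn nat_case.
  by rewrite NegzE mulrNz -pmulrn mulrN -(nat_case k.+1) subrK.
have nat_case k y : exists2 c : C, c != 0 & forall i, theta2 i (y + ell * k%:R) = c * theta2 i y.
  elim: k => [|k [c c0 h]]; first by exists 1 => [|i]; rewrite ?oner_eq0// mulr0 addr0 mul1r.
  exists (cexp (- (2 * (y + ell * k%:R))) * c) => [|i]; first by rewrite mulf_neq0// cexp_neq0.
  by rewrite -natr1 mulrDr mulr1 addrA theta2Dell h mulrA.
move=> z; have [k [kn|kn]] : exists k : nat, n = k \/ n = - k%:Z.
  by case: (n) => k; [exists k; left|exists k.+1; right].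
  have [c c0 h] := nat_case k (z + twopii * m%:~R).
  by exists c => // i; rewrite kn addrA -pmulrn h tpi_int.
have [c c0 h] := nat_case k (z + twopii * m%:~R - ell * k%:R).
exists c^-1 => [|i]; first by rewrite invr_eq0.
apply: (mulfI c0); rewrite mulVKf// kn mulrNz -pmulrn mulrN addrA -h subrK.
exact: tpi_int.
Qed.

Lemma theta0 : theta 0 = 0.
Proof.
have := @theta_estimate 0 _; rewrite cexp0 subrr normc0 mulr0 subr0.
rewrite /= normr0 => /(_ (ltac:(lra))) h; apply: eq0_normc.
by apply/eqP; rewrite eq_le h normc_ge0.
Qed.

Definition dtheta (z : C) := laurent (deriv_coef theta_coef) z.
Definition dtheta2 i (z : C) := laurent (deriv_coef (theta2_coef i)) z.

Lemma is_derive_theta z : is_derive z (1 : C) theta (dtheta z).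
Proof. by apply: is_derive_laurent; exact: rapid_theta_coef. Qed.

Lemma is_derive_theta2 i z : is_derive z (1 : C) (theta2 i) (dtheta2 i z).
Proof. by apply: is_derive_laurent; exact: rapid_theta2_coef. Qed.

(** By the estimate, |theta(h)| is at least |1 - e^h| / 2, which is of order one
    in h; were the derivative zero, theta(h) would be of order two. *)
Lemma dtheta0 : dtheta 0 != 0.
Proof.
apply/eqP => d0.
have [K hK] := @laurent_expand _ 0 rapid_theta_coef.
pose e := expR 1 : R; have e0 : 0 < e by exact: expR_gt0.
(* The two remainders give h <= (2 |K| + 5 e) h^2, false for h = 1 / D. *)
pose D := 2 * `|K| + 5 * e + 1.
have K0 := normr_ge0 K; have D1 : 1 < D by rewrite /D; lra.
pose t := D^-1; have t0 : 0 < t by rewrite invr_gt0; lra.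
have t1 : t < 1 by rewrite invf_lt1//; lra.
have tD : t * D = 1 by rewrite mulVf// gt_eqF//; lra.
pose h : C := real_complex R t.
have nh : normc h = t by rewrite /= expr0n/= addr0 sqrtr_sqr gtr0_norm.
have := hK h; rewrite nh => /(_ (ltW t1)).
rewrite add0r -/theta theta0 subr0 -/(dtheta 0) d0 mulr0 subr0 => h1.
have hr : `|Re h| <= 4 by rewrite /= gtr0_norm//; lra.
have h2 := theta_estimate hr.
have := normc_cexp_sub1x h; rewrite nh => h3.
have h4 : expR t <= e by rewrite ler_expR ltW.
have h5 : normc (1 - cexp h) <= normc (theta h - (1 - cexp h)) + normc (theta h).
  rewrite -[X in normc X <= _](_ : - (theta h - (1 - cexp h)) + theta h = _); last by ring.
  by apply: le_trans (le_normcD _ _) _; rewrite normcN.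
have h6 : normc h <= normc (cexp h - 1 - h) + normc (1 - cexp h).
  rewrite -[X in normc X <= _](_ : - (cexp h - 1 - h) + - (1 - cexp h) = _); last by ring.
  by apply: le_trans (le_normcD _ _) _; rewrite !normcN.
rewrite nh in h6.
have h7 : t <= 5 * t ^+ 2 * e + 2 * (`|K| * t ^+ 2).
  have h3' : 5 * t ^+ 2 * expR t <= 5 * t ^+ 2 * e by rewrite ler_wpM2l// mulr_ge0// exprn_ge0// ltW.
  have h1' : K * t ^+ 2 <= `|K| * t ^+ 2 by rewrite ler_wpM2r ?ler_norm// exprn_ge0// ltW.
  have h1'' : normc (theta h) <= K * t ^+ 2 := h1.
  move: h2 h3 h5 h6 h1'' h1' h3'.
  set x := normc (1 - _); set y := normc (theta h - _).
  set w := normc (cexp h - _ - _); set v := normc (theta _).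
  lra.
have : t * D <= t * (1 - t).
  move: h7 tD; rewrite /D; nra.
nra.
Qed.

Lemma is_derive_shift (f : C -> C) (a z d : C) :
  is_derive (z + a) (1 : C) f d -> is_derive z (1 : C) (fun x => f (x + a)) d.
Proof.
move=> [df dfE].
have e : (fun h : C => h^-1 *: (((fun x => f (x + a)) \o shift z) (h *: (1 : C)) - f (z + a))) =
         (fun h : C => h^-1 *: ((f \o shift (z + a)) (h *: (1 : C)) - f (z + a))).
  by apply/funext => h; rewrite /= addrA.
by apply: DeriveDef; [rewrite /derivable e|rewrite /derive e].
Qed.

(** Differentiate [theta_split] with respect to x at x = a: the right-hand side
    gives the Wronskian, and the left-hand side theta(2 a) theta'(0). *)
Lemma wronskian a : dtheta2 false a * theta2 true a = dtheta2 true a * theta2 false a -> Lam (a + a).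
Proof.
move=> w; apply: theta_zero.
have d1 : is_derive a (1 : C) (fun x => theta (x + a) * theta (x - a)) (theta (a + a) * dtheta 0).
  have h1 : is_derive a (1 : C) (fun x => theta (x + a)) (dtheta (a + a)).
    exact/is_derive_shift/is_derive_theta.
  have h2 : is_derive a (1 : C) (fun x => theta (x - a)) (dtheta (a - a)).
    exact/is_derive_shift/is_derive_theta.
  have := is_deriveM h1 h2; rewrite subrr theta0 scale0r addr0; apply.
have d2 : is_derive a (1 : C) (fun x => theta (x + a) * theta (x - a)) 0.
  pose k := qpow 1 * cexp (- a).
  have -> : (fun x => theta (x + a) * theta (x - a)) =
    (k * theta2 true a) *: theta2 false - (k * theta2 false a) *: theta2 true.
    by apply/funext => x; rewrite theta_split !fctE /GRing.scale/= -/k; ring.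
  have h := is_deriveB (is_deriveZ (k * theta2 true a) (is_derive_theta2 false a))
    (is_deriveZ (k * theta2 false a) (is_derive_theta2 true a)).
  have e : (k * theta2 true a) *: dtheta2 false a - (k * theta2 false a) *: dtheta2 true a = 0.
    by rewrite /GRing.scale/= -!mulrA (mulrC (theta2 true a)) w (mulrC (theta2 false a)) subrr.
  by rewrite -e.
have := @derive_val _ _ _ _ _ _ _ d1; rewrite (@derive_val _ _ _ _ _ _ _ d2) => /esym/eqP.
by rewrite mulf_eq0 (negbTE dtheta0) orbF => /eqP.
Qed.

(** The hypothesis says that [theta2] takes the same value at x and y, as a map
    to the projective line. *)
Lemma theta2_cross x y : theta2 false x * theta2 true y = theta2 true x * theta2 false y ->
  Lam (x + y) \/ Lam (x - y).
Proof.
move=> h; have := theta_split x y; rewrite h subrr mulr0 => /eqP.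
by rewrite mulf_eq0 => /orP[/eqP/theta_zero|/eqP/theta_zero]; [left|right].
Qed.

(** A common zero x would give theta(x + a) theta(x - a) = 0 for all a.  For
    a = 1 - x and a = 2 - x the first factor is not zero, and the two second
    factors differ by 1, which is not a period. *)
Lemma theta2_neq0 x : exists i, theta2 i x != 0.
Proof.
apply: contrapT => /forallNP h.
have {}h i : theta2 i x = 0 by apply/eqP/negPn/negP/h.
have c (a : C) : Lam (x + a) \/ Lam (x - a).
  by apply: theta2_cross; rewrite !h !mul0r.
have [|h1] := c (1 - x).
  by rewrite addrC subrK; move/(@not_Lam_int 1); apply.
have [|h2] := c (2 - x).
  by rewrite addrC subrK; move/(@not_Lam_int 2); apply.
have e : x - (1 - x) - (x - (2 - x)) = 1 by ring.
have := Lam_add h1 (Lam_opp h2); rewrite e.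
by move/(@not_Lam_int 1); apply.
Qed.

(** * The abelian threefold *)

Definition period_mx : 'M[C]_(3.*2, 3) := (col_mx twopii%:M ell%:M : 'M_(3 + 3, 3)).

Lemma mul_period_mx (c d : 'rV[C]_3) j :
  ((row_mx c d : 'rV[C]_(3.*2)) *m period_mx) 0 j = twopii * c 0 j + ell * d 0 j.
Proof.
rewrite /period_mx -[_ *m _]/(row_mx c d *m col_mx twopii%:M ell%:M : 'rV[C]_3).
by rewrite mul_row_col !mul_mx_scalar !mxE.
Qed.

Lemma split_row (S T : Type) (f : S -> T) (c : 'rV[S]_(3.*2)) :
  map_mx f c = (row_mx (map_mx f (lsubmx (c : 'rV_(3 + 3))))
    (map_mx f (rsubmx (c : 'rV_(3 + 3)))) : 'rV_(3 + 3)).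
Proof.
rewrite -[in LHS](hsubmxK (c : 'rV_(3 + 3))); exact: (@map_row_mx _ _ f 1 3 3).
Qed.

Lemma periods_free (a b : R) :
  twopii * real_complex R a + ell * real_complex R b = 0 -> a = 0 /\ b = 0.
Proof.
rewrite /twopii /ell -(rmorph_nat (real_complex R)) -rmorphN => /eqP.
rewrite eq_complex/= => /andP[/eqP h1 /eqP h2]; have p0 := pi_gt0 R; split.
  apply/eqP; have : pi *+ 2 * a = 0 by lra.
  by move=> /eqP; rewrite mulf_eq0 mulrn_eq0/= gt_eqF.
lra.
Qed.

Lemma is_period_mx : is_period_matrix period_mx.
Proof.
move=> c; rewrite split_row => h.
have hj j : lsubmx (c : 'rV_(3 + 3)) 0 j = 0 /\ rsubmx (c : 'rV_(3 + 3)) 0 j = 0.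
  apply: periods_free.
  have := mul_period_mx (map_mx (real_complex R) (lsubmx (c : 'rV_(3 + 3))))
    (map_mx (real_complex R) (rsubmx (c : 'rV_(3 + 3)))) j.
  by rewrite h !mxE => <-.
have e1 : lsubmx (c : 'rV_(3 + 3)) = 0 by apply/rowP => j; rewrite [RHS]mxE; have [] := hj j.
have e2 : rsubmx (c : 'rV_(3 + 3)) = 0 by apply/rowP => j; rewrite [RHS]mxE; have [] := hj j.
by rewrite -[c](@hsubmxK _ 1 3 3) e1 e2; exact: (@row_mx0 R 1 3 3).
Qed.

Lemma latticeP (z : 'rV[C]_3) : z \in lattice period_mx <-> forall j, Lam (z 0 j).
Proof.
split=> [/asboolP[m ->] j|].
  exists (lsubmx (m : 'rV_(3 + 3)) 0 j), (rsubmx (m : 'rV_(3 + 3)) 0 j).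
  by rewrite split_row [LHS]mul_period_mx !mxE.
move=> /choice[m] /choice[n h]; apply/asboolP.
exists (row_mx (\row_j m j) (\row_j n j) : 'rV_(3 + 3)).
by apply/rowP => j; rewrite h split_row [RHS]mul_period_mx row_mxKl row_mxKr !mxE.
Qed.

(** The six maps to the projective line: for each coordinate j, the map of degree
    two applied to z_j, and to z_j + 2. *)
Definition slot := ('I_3 * bool)%type.
Definition slot_arg (k : slot) (z : 'rV[C]_3) : C := z 0 k.1 + 2 * k.2%:R.
Definition segre_coord (e : {ffun slot -> bool}) (z : 'rV[C]_3) : C :=
  \prod_k theta2 (e k) (slot_arg k z).

Definition segre_dim := #|{ffun slot -> bool}|.-1.
(** Homogeneous coordinates are numbered by the position of the choice in the
    enumeration; the default value of [nth] is not reached. *)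
Definition coord_index (l : 'I_segre_dim.+1) : {ffun slot -> bool} := nth [ffun => false] (enum {ffun slot -> bool}) l.

Lemma coord_index_surj e : exists l, coord_index l = e.
Proof.
have h : (index e (enum {ffun slot -> bool}) < segre_dim.+1)%N.
  rewrite prednK; last by apply/card_gt0P; exists e.
  by rewrite cardE index_mem mem_enum.
by exists (Ordinal h); rewrite /coord_index nth_index// mem_enum.
Qed.

Definition segre_map (z : 'rV[C]_3) : 'rV[C]_segre_dim.+1 := \row_l segre_coord (coord_index l) z.

Lemma segre_map_scale z w (c : C) : (forall e, segre_coord e z = c * segre_coord e w) <-> segre_map z = c *: segre_map w.
Proof.
split=> [h|h e]; first by apply/rowP => l; rewrite !mxE h.
by have [l <-] := coord_index_surj e; have /rowP/(_ l) := h; rewrite !mxE.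
Qed.

Lemma segre_map_quasiperiodic z w : z - w \in lattice period_mx ->
  exists2 c : C, c != 0 & segre_map z = c *: segre_map w.
Proof.
move=> /latticeP zw.
have /choice[c hc] : forall k : slot, exists c : C, c != 0 /\
    forall i, theta2 i (slot_arg k z) = c * theta2 i (slot_arg k w).
  move=> k; have [c c0 hc] := theta2_quasiperiodic (zw k.1) (slot_arg k w); exists c; split=> // i.
  rewrite -hc /slot_arg; congr theta2; rewrite !mxE; ring.
exists (\prod_k c k); first by apply/prodf_neq0 => k _; have [] := hc k.
apply/segre_map_scale => e; rewrite /segre_coord -big_split; apply: eq_bigr => k _.
by have [_ ->] := hc k.
Qed.

Lemma segre_map_neq0 z : segre_map z != 0.
Proof.
have [e he] := @segre_nonzero C slot (fun k i => theta2 i (slot_arg k z)) (fun k => theta2_neq0 (slot_arg k z)).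
apply/eqP => h; have : segre_map z = 0 *: segre_map z by rewrite scale0r.
move/segre_map_scale/(_ e)/eqP; rewrite mul0r; apply/negP.
by apply/prodf_neq0 => k _; exact: he.
Qed.

Lemma not_Lam_4 : ~ Lam 4.
Proof. exact: (@not_Lam_int 4). Qed.

(** At each j, the two maps of degree two give w_j = z_j or w_j = - z_j, and
    w_j = z_j or w_j + 2 = - (z_j + 2), modulo periods.  Both second cases together
    would make 4 a period. *)
Lemma segre_map_inj z w (c : C) : segre_map z = c *: segre_map w -> z - w \in lattice period_mx.
Proof.
move=> /segre_map_scale h; apply/latticeP => j.
have cross := @segre_inj C slot (fun k i => theta2 i (slot_arg k z)) (fun k i => theta2 i (slot_arg k w))
  c (fun k => theta2_neq0 (slot_arg k z)) h.
have [] := theta2_cross (cross (j, false)); last by rewrite /slot_arg !mxE/= mulr0 !addr0.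
have [] := theta2_cross (cross (j, true)).
  rewrite /slot_arg/= => h1 h2; exfalso; apply: not_Lam_4.
  have := Lam_add h1 (Lam_opp h2); congr (Lam _); ring.
by move=> + _; rewrite /slot_arg /= !mxE; congr (Lam _); ring.
Qed.

Lemma differentiable_theta2 i x : differentiable (theta2 i) x.
Proof.
by apply/derivable1_diffP; have [] := is_derive_theta2 i x.
Qed.

Lemma derive_theta2_arg i k z v : differentiable (fun z => theta2 i (slot_arg k z)) z /\
  'D_v (fun z => theta2 i (slot_arg k z)) z = v 0 k.1 * dtheta2 i (slot_arg k z).
Proof.
have darg : differentiable (slot_arg k) z.
  apply: differentiableD; [exact: differentiable_coord|exact: differentiable_cst].
have d : differentiable (fun z => theta2 i (slot_arg k z)) z.
  exact: (differentiable_comp darg (differentiable_theta2 i _)).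
split=> //; rewrite deriveE//.
rewrite (@diff_comp _ _ _ _ (slot_arg k) (theta2 i) z darg (differentiable_theta2 i _))/=.
have -> : 'd (slot_arg k) z v = v 0 k.1.
  rewrite -deriveE//; apply/cvg_lim; first exact: norm_hausdorff.
  apply: cvg_near_cst; near=> h.
  have h0 : h != 0 by near: h; exact: (@nbhs_dnbhs_neq C 0).
  rewrite /= /slot_arg !mxE -[_ *: _]/(h^-1 * _).
  by field.
rewrite -[v 0 k.1]mulr1 -[v 0 k.1 * 1]/(v 0 k.1 *: 1) linearZ/= -deriveE; last exact: differentiable_theta2.
have [_ ->] := is_derive_theta2 i (slot_arg k z); rewrite -[_ *: dtheta2 _ _]/(_ * _) -[_ *: 1]/(_ * 1).
by rewrite mulr1.
Unshelve. all: by end_near.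
Qed.

Lemma differentiable_segre_coord e z : differentiable (segre_coord e) z.
Proof. by apply: differentiable_prod => k; have [] := derive_theta2_arg (e k) k z 0. Qed.

Lemma differentiable_segre_map z : differentiable segre_map z.
Proof.
apply: differentiable_row => l; under eq_fun do rewrite mxE.
exact: differentiable_segre_coord.
Qed.

(** Fix a slot and a choice of nonvanishing factors elsewhere, with product P.
    The coordinates B0 P and B1 P have derivatives along v proportional to them,
    with the same factor; eliminating the derivative of P leaves
    v_j (B0' B1 - B1' B0) = 0.  So v_j <> 0 would make both 2 z_j and
    2 (z_j + 2) periods. *)
Lemma segre_map_immersion z v (c : C) : 'D_v segre_map z = c *: segre_map z -> v = 0.
Proof.
move=> h; apply/rowP => j; rewrite mxE; apply/eqP; apply: contraT => vj0.
have key s : Lam (slot_arg (j, s) z + slot_arg (j, s) z).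
  set k := (j, s); apply: wronskian.
  have [e he] := @segre_nonzero C slot (fun k i => theta2 i (slot_arg k z)) (fun k => theta2_neq0 (slot_arg k z)).
  pose P (y : 'rV[C]_3) := \prod_(k' | k' != k) theta2 (e k') (slot_arg k' y).
  have P0 : P z != 0 by apply/prodf_neq0 => k' _; exact: he.
  have dP : differentiable P z.
    by apply: differentiable_prod => k'; have [] := derive_theta2_arg (e k') k' z 0.
  have hi i : theta2 i (slot_arg k z) * 'D_v P z + P z * (v 0 j * dtheta2 i (slot_arg k z)) =
      c * (theta2 i (slot_arg k z) * P z).
    have [d1 d2] := derive_theta2_arg i k z v.
    rewrite -d2 -[LHS](deriveM (diff_derivable d1) (diff_derivable dP)).
    have [l hl] := coord_index_surj (upd e k i).
    have <- : segre_coord (coord_index l) = (fun y => theta2 i (slot_arg k y)) * P.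
      by apply/funext => y; rewrite /segre_coord hl (@prod_upd C slot (fun k i => theta2 i (slot_arg k y))).
    have := derive_coord l (diff_derivable (differentiable_segre_map z) : derivable segre_map z v).
    rewrite h !mxE; under eq_fun do rewrite mxE.
    by move=> ->; rewrite /segre_coord hl (@prod_upd C slot (fun k i => theta2 i (slot_arg k z))).
  apply: (mulfI (mulf_neq0 P0 vj0)).
  have h2 i : P z * (v 0 j * dtheta2 i (slot_arg k z)) = (c * P z - 'D_v P z) * theta2 i (slot_arg k z).
    have := hi i; move: ('D_v P z) => d e2.
    have -> : (c * P z - d) * theta2 i (slot_arg k z) =
      c * (theta2 i (slot_arg k z) * P z) - theta2 i (slot_arg k z) * d by ring.
    rewrite -e2; ring.
  transitivity (P z * (v 0 j * dtheta2 false (slot_arg k z)) * theta2 true (slot_arg k z)); first by ring.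
  rewrite h2 mulrAC -h2; ring.
exfalso; apply: not_Lam_4.
have := Lam_add (key true) (Lam_opp (key false)); congr (Lam _); rewrite /slot_arg/=; ring.
Qed.

Lemma segre_map_embedding :
  is_projective_embedding (fun a : torus period_mx => segre_map (repr a)).
Proof.
split=> [a|a b [c h]|z]; first exact: segre_map_neq0.
  rewrite -[a]reprK -[b]reprK; apply/to_torus_eq; exact: segre_map_inj h.
exists segre_map; split.
- by apply: (@filterE _ (nbhs z) (nbhs_filter z)) => w; exact: differentiable_segre_map.
- apply: (@filterE _ (nbhs z) (nbhs_filter z)) => w.
  have [|c _ hc] := @segre_map_quasiperiodic (repr (to_torus period_mx w)) w.
    by apply/to_torus_eq; exact: reprK.
  by exists c.
- by move=> v [c /segre_map_immersion].
Qed.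

Definition ecube : abelianVariety R 3 := AbelianVariety is_period_mx segre_map_embedding.

(** * The entire curve *)

Definition prim_coef i (n : int) : C := n%:~R^-1 * theta2_coef i n.

Lemma rapid_prim_coef i : rapid (prim_coef i).
Proof.
apply: (rapid_dom (K := 1) (kappa := 0) (@rapid_theta2_coef i)) => n.
rewrite mul0r expR0 mul1r mulr1 normcM.
rewrite ler_piMl ?normc_ge0// normcV normc_int.
have [->|n0] := eqVneq (absz n) 0%N; first by rewrite invr0.
by rewrite invf_le1 ?ltr0n ?lt0n// ler1n lt0n.
Qed.

(** The constant term of the Fourier series is integrated apart, so the term
    n = 0 of [prim_coef] must be zero: it is, as the inverse of 0 is 0. *)
Definition theta2_prim i (t : C) : C := theta2_coef i 0 * t + laurent (prim_coef i) t.

Lemma is_derive_theta2_prim i t : is_derive t (1 : C) (theta2_prim i) (theta2 i t).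
Proof.
have h := @is_derive_laurent _ t (@rapid_prim_coef i).
have hid := is_deriveZ (theta2_coef i 0) (is_derive_id t (1 : C)).
have := is_deriveD hid h.
suff -> : theta2 i t = theta2_coef i 0 *: 1 + laurent (deriv_coef (prim_coef i)) t by [].
apply: laurentE.
pose u (n : int) : C := if n == 0 then theta2_coef i 0 else 0.
have hu : has_sum u (theta2_coef i 0).
  have := @has_sum_fin int C u [fset 0]%fset; rewrite big_seq_fset1; apply.
  by move=> n; rewrite inE /u => /negbTE ->.
have := has_sumD hu (has_sum_laurent t (rapid_deriv_coef (@rapid_prim_coef i))).
rewrite -[_ *: 1]/(_ * 1) mulr1.
congr (has_sum _ _); apply/funext => n; rewrite /u /laurent_term /deriv_coef /prim_coef.
case: eqVneq => [->|n0]; first by rewrite !mul0r cexp0 mulr1 addr0.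
by rewrite add0r mulrA mulfV ?mul1r// intr_eq0.
Qed.

Lemma theta2_primD2pi i t (k : nat) :
  theta2_prim i (t + twopii * k%:R) = theta2_prim i t + theta2_coef i 0 * twopii * k%:R.
Proof.
elim: k => [|k IH]; first by rewrite !mulr0 !addr0.
rewrite -natr1 mulrDr mulr1 addrA /theta2_prim laurentD2pi.
move: IH; rewrite /theta2_prim => /(canRL (addKr _)) ->; ring.
Qed.

Lemma theta2_coef0 i : theta2_coef i 0 = (~~ i)%:R.
Proof.
rewrite /theta2_coef mul0r /qpow mulr0 cexp0 mulr1; case: i => /=.
  by rewrite expr1 mulN1r subrr mul0r.
by rewrite expr0 mul1r; field.
Qed.

Section Curve.
Variables alpha beta : C.
Hypothesis alpha0 : alpha != 0.

Definition curve_lift (t : C) : 'rV[C]_3 :=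
  \row_j (if j == 0 then t else if j == 1 then alpha * theta2_prim false t
     else beta * theta2_prim false t + theta2_prim true t).

Definition curve_velocity (t : C) : 'rV[C]_3 :=
  \row_j (if j == 0 then 1 else if j == 1 then alpha * theta2 false t
     else beta * theta2 false t + theta2 true t).

Lemma derivable_curve_lift t : derivable curve_lift t 1.
Proof.
apply/derivable1_diffP; apply: differentiable_row => j.
under eq_fun do rewrite mxE.
case: (j == 0); first exact: ex_diff.
have dp i : differentiable (theta2_prim i) t.
  by apply/derivable1_diffP; have [] := is_derive_theta2_prim i t.
by case: (j == 1); [exact: differentiableZ|apply: differentiableD (dp true); exact: differentiableZ].
Qed.

Lemma derive1_curve_lift t : derive1 curve_lift t = curve_velocity t.
Proof.
rewrite derive1E; apply/rowP => j; rewrite -derive_coord; last exact: derivable_curve_lift.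
rewrite mxE; under eq_fun do rewrite mxE.
case: (j == 0); first by rewrite derive_id.
case: (j == 1).
  by have [_ h] := is_deriveZ alpha (is_derive_theta2_prim false t); exact: h.
by have [_ h] := is_deriveD (is_deriveZ beta (is_derive_theta2_prim false t)) (is_derive_theta2_prim true t); exact: h.
Qed.

Definition curve (t : C) : ecube := to_torus period_mx (curve_lift t).

Lemma local_lift_curve t : local_lift curve t curve_lift.
Proof. by apply: (@filterE _ (nbhs t) (nbhs_filter t)) => s; split; [exact: derivable_curve_lift|]. Qed.

Lemma holomorphic_curve : holomorphic curve.
Proof. by move=> t; exists curve_lift; exact: local_lift_curve. Qed.

Lemma jet_curve t : jet curve t = (curve t, curve_velocity t).
Proof. by rewrite (jetE (local_lift_curve t)) derive1_curve_lift. Qed.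

Lemma hcoord_to_torus (z : 'rV[C]_3) :
  exists2 c : C, c != 0 & hcoord (to_torus period_mx z : ecube) = c *: segre_map z.
Proof.
apply: segre_map_quasiperiodic; apply/to_torus_eq; exact: reprK.
Qed.

Lemma curve_velocity1 t : curve_velocity t 0 1 = alpha * theta2 false t.
Proof. by rewrite mxE. Qed.

Lemma curve_velocity2 t : curve_velocity t 0 2 = beta * theta2 false t + theta2 true t.
Proof. by rewrite mxE. Qed.

Lemma segre_coord_upd e k i z : segre_coord (upd e k i) z =
  theta2 i (slot_arg k z) * \prod_(k' | k' != k) theta2 (e k') (slot_arg k' z).
Proof. exact: (@prod_upd C slot (fun k i => theta2 i (slot_arg k z))). Qed.

Lemma segre_mapE (c : C) (z : 'rV[C]_3) l : (c *: segre_map z) 0 l = c * segre_coord (coord_index l) z.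
Proof. by rewrite !mxE. Qed.

(** The relation between point and velocity is written with the Segre
    coordinates that differ in the slot (0, false) only, whose quotient is
    B0(x_0) : B1(x_0).  For a product, it could be evaluated at the velocity of
    time 0 and at a point with x_0 = 1; then 1 would be a period. *)
Lemma jet_closure_not_product : ~ exists W : set 'rV[C]_3,
  algebraic_affine W /\ zariski_closure (range (jet curve)) = [set: ecube] `*` W.
Proof.
move=> [W [_ hW]].
pose k : slot := (0, false).
(* v_1 X_l' = (alpha v_2 - beta v_1) X_l *)
pose Y (j : 'I_3) : mpoly.mpoly 3 C := mpoly.mpolyX _ (mpoly.mnm1 j).
pose S : set (mpoly.mpoly (pdim ecube).+1 (mpoly.mpoly 3 C)) :=
  [set p | exists l l' e, [/\ coord_index l = upd e k false, coord_index l' = upd e k true &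
     p = binom_poly (Y 1) (alpha *: Y 2 - beta *: Y 1) l' l]].
pose Z : set (ecube * 'rV[C]_3) := [set x : ecube * 'rV[C]_3 | forall p, S p ->
  mpoly.mmap (mpoly.meval (x.2 0)) (hcoord (x.1 : ecube) 0) p = 0].
have Zalg : algebraic_prod Z.
  by exists S; split=> // p [l [l' [e [_ _ ->]]]]; exact: binom_poly_homogeneous.
have YE w : mpoly.meval w (alpha *: Y 2 - beta *: Y 1) = alpha * w 2 - beta * w 1.
  by rewrite mpoly.mevalB !mpoly.mevalZ !mpoly.mevalXU.
have Zjet : range (jet curve) `<=` Z.
  move=> _ [t _ <-] p [l [l' [e [el el' ->]]]].
  rewrite binom_polyE YE mpoly.mevalXU jet_curve.
  have [c c0 hc] := hcoord_to_torus (curve_lift t).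
  rewrite hc !segre_mapE el el' !segre_coord_upd !curve_velocity1 curve_velocity2.
  have -> : slot_arg k (curve_lift t) = t by rewrite /slot_arg mxE/= mulr0 addr0.
  set P := \prod_(_ | _) _; ring.
pose z : 'rV[C]_3 := delta_mx 0 0.
have hz : Z (to_torus period_mx z, curve_velocity 0).
  suff : zariski_closure (range (jet curve)) (to_torus period_mx z, curve_velocity 0).
    by apply.
  rewrite hW; split=> //=.
  suff : zariski_closure (range (jet curve)) (jet curve 0) by rewrite hW jet_curve => -[].
  by move=> M [_ hM]; apply: hM; exists 0.
have [c c0 hc] := hcoord_to_torus z.
have [e he] := @segre_nonzero C slot (fun k i => theta2 i (slot_arg k z)) (fun k => theta2_neq0 (slot_arg k _)).
have [l el] := coord_index_surj (upd e k false); have [l' el'] := coord_index_surj (upd e k true).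
have := hz _ (ex_intro _ l (ex_intro _ l' (ex_intro _ e (And3 el el' erefl)))).
rewrite binom_polyE YE mpoly.mevalXU hc !segre_mapE el el'.
rewrite !segre_coord_upd !curve_velocity1 curve_velocity2.
set P := \prod_(_ | _) _.
have P0 : P != 0 by apply/prodf_neq0 => k' _; exact: he.
have -> : slot_arg k z = 1 by rewrite /slot_arg mxE/= mulr0 addr0.
move=> h.
have : Lam (0 + 1) \/ Lam (0 - 1).
  apply: theta2_cross; apply/eqP; rewrite -subr_eq0; apply/eqP.
  apply: (mulfI (mulf_neq0 (mulf_neq0 alpha0 c0) P0)); rewrite mulr0.
  by apply: etrans h; ring.
by rewrite add0r sub0r => -[|/Lam_opp]; rewrite ?opprK; apply: (@not_Lam_int 1).
Qed.

(** A homogeneous polynomial in the Segre coordinates is a continuous function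
    on C^3 whose zero set is invariant under the lattice. *)
Lemma zariski_dense_curve :
  (forall (z : 'rV[C]_3) (e : R), 0 < e -> exists t lam, lam \in lattice period_mx /\
     forall j, normc (z 0 j - (curve_lift t + lam) 0 j) < e) ->
  zariski_dense (range curve).
Proof.
move=> hd; apply/seteqP; split=> // a _ Z [[S [Shom ->]] hZ] p Sp.
pose Phi (z : 'rV[C]_3) := mpoly.meval (segre_map z 0) p.
have cPhi z : {for z, continuous Phi}.
  apply: differentiable_continuous; apply: differentiable_meval.
  exact: differentiable_segre_map.
apply/eqP; rewrite -[_ == _]/(Phi (repr a) == 0); apply: contraT => Phi0.
have /nbhs_ballP[[e e'] /= + he] : nbhs (repr a : 'rV[C]_3) (Phi @^-1` [set y | y != 0]).
  exact: (cvgr_neq0 _ (cPhi (repr a)) Phi0).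
rewrite ltcE/= => /andP[/eqP e'0 e0]; rewrite {}e'0 in he.
have [t [lam [lamL hlam]]] := hd (repr a) e e0.
have /he/eqP[] : ball (repr a : 'rV[C]_3) (Complex e 0 : C) (curve_lift t + lam).
  split=> [|i j]; first by rewrite ltcR.
  rewrite ord1; have := hlam j; rewrite -ltcR; exact.
have [c c0 hc] : exists2 c : C, c != 0 & hcoord (curve t) = c *: segre_map (curve_lift t + lam).
  apply: segre_map_quasiperiodic; rewrite opprD addrA rpredB//.
  by apply/to_torus_eq; exact: reprK.
have [d hdd] := meval_homogeneous (segre_map (curve_lift t + lam) 0) c (Shom p Sp).
have : mpoly.meval (hcoord (curve t) 0) p = 0 by apply: (hZ (curve t)) => //; exists t.
rewrite hc (mpoly.meval_eq (v2 := fun i => c * segre_map (curve_lift t + lam) 0 i)); last by move=> i; rewrite mxE.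
by rewrite hdd => /eqP; rewrite mulf_eq0 expf_eq0 (negbTE c0) andbF => /eqP.
Qed.
End Curve.

(** * Density of the curve *)

(** Real coordinates of the line in the basis of periods. *)
Definition period_comb (x y : R) : C := twopii * rc x + ell * rc y.

Lemma twopii_neq0 : twopii != 0.
Proof.
by rewrite /twopii eq_complex/= negb_and orbC mulrn_eq0/= gt_eqF ?pi_gt0.
Qed.

Lemma period_combE (x y : R) : period_comb x y = Complex (- 8 * y) (pi *+ 2 * x).
Proof.
rewrite /period_comb /twopii /ell -(rmorph_nat rc) -rmorphN.
by apply/eqP; rewrite eq_complex/=; apply/andP; split; apply/eqP; ring.
Qed.

Lemma period_comb_surj (w : C) : exists x y, w = period_comb x y.
Proof.
case: w => a b; exists (b / (pi *+ 2)), (- a / 8); rewrite period_combE.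
have p0 := pi_gt0 R; apply/eqP; rewrite eq_complex/=; apply/andP; split; apply/eqP; first by field.
by rewrite mulrC divfK// mulrn_eq0/= gt_eqF.
Qed.

Lemma normc_period_comb (x y e : R) : `|x| < e -> `|y| < e -> normc (period_comb x y) < e * (pi *+ 2 + 8).
Proof.
move=> xe ye; rewrite period_combE; apply: le_lt_trans (normc_le _) _ => /=.
have p0 := pi_gt0 R; have p2 : 0 < pi *+ 2 :> R by rewrite mulrn_wgt0.
rewrite !normrM normrN (gtr0_norm p2) (ger0_norm (_ : 0 <= 8))//.
rewrite mulrDr addrC; apply: ltrD; first by rewrite mulrC ltr_pM2r.
by rewrite mulrC ltr_pM2r.
Qed.

(** At the time t = z_0 + 2 pi i k, the two last coordinates of the lift are
    constants plus k times the vector 2 pi i (alpha, beta), whose four real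
    coordinates in the basis of periods are chosen with dense multiples modulo
    integers.  The first of them cannot be 0, as its multiples approach 1 / 2
    modulo integers; hence alpha <> 0. *)
Lemma exists_dense_curve_lift : exists alpha beta : C, alpha != 0 /\
  forall (z : 'rV[C]_3) (e : R), 0 < e -> exists t lam, lam \in lattice period_mx /\
     forall j, normc (z 0 j - (curve_lift alpha beta t + lam) 0 j) < e.
Proof.
have [r hr] := exists_dense_multiples R 3.
pose r_ (i : nat) : R := r 0 (inord i).
pose alpha := period_comb (r_ 0%N) (r_ 1%N) / twopii; pose beta := period_comb (r_ 2%N) (r_ 3%N) / twopii.
have halpha : alpha * twopii = period_comb (r_ 0%N) (r_ 1%N) by rewrite divfK// twopii_neq0.
have hbeta : beta * twopii = period_comb (r_ 2%N) (r_ 3%N) by rewrite divfK// twopii_neq0.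
have approxP (s : nat -> R) (e : R) : 0 < e -> exists (k : nat) (m : nat -> int),
    forall i : nat, (i < 4)%N -> `|k%:R * r_ i - (m i)%:~R - s i| < e.
  move=> e0; have [k [m h]] := hr (\row_i s i) e e0.
  exists k, (fun i => m (inord i)) => i i4.
  by have := h (inord i); rewrite mxE inordK.
exists alpha, beta; split.
  apply/eqP => alpha0; have [|k [m h]] := @approxP (fun=> 2^-1) 4^-1; first by rewrite invr_gt0.
  have r0 : r_ 0%N = 0.
    have : period_comb (r_ 0%N) (r_ 1%N) = 0 by rewrite -halpha alpha0 mul0r.
    by move=> /periods_free[].
  have := h 0%N isT; rewrite r0 mulr0 sub0r ltr_norml => /andP[h1 h2].
  have h3 : (-1)%:~R < (m 0%N)%:~R :> R by rewrite mulrNz; lra.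
  have h4 : (m 0%N)%:~R < 0%:~R :> R by rewrite mulr0z; lra.
  by move: h3 h4; rewrite !ltr_int; lia.
move=> z e e0.
have p2 : 0 < pi *+ 2 + 8 :> R by rewrite addr_gt0// mulrn_wgt0// pi_gt0.
have [s0 [s1 h1]] := period_comb_surj (z 0 1 - alpha * theta2_prim false (z 0 0)).
have [s2 [s3 h2]] := period_comb_surj (z 0 2 - (beta * theta2_prim false (z 0 0) + theta2_prim true (z 0 0))).
have [|k [m h]] := @approxP (fun i => nth 0 [:: s0; s1; s2; s3] i) (e / (pi *+ 2 + 8)).
  by rewrite divr_gt0.
exists (z 0 0 + twopii * k%:R).
exists (\row_j (if j == 0 then - (twopii * k%:R) else
   if j == 1 then - period_comb (m 0%N)%:~R (m 1%N)%:~R else - period_comb (m 2%N)%:~R (m 3%N)%:~R)).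
have ptL (a b : int) : Lam (- period_comb a%:~R b%:~R).
  by apply: Lam_opp; exists a, b; rewrite /period_comb !rmorph_int.
split.
  apply/latticeP => j; rewrite mxE; case: ifP => _; last by case: ifP.
  by apply: Lam_opp; exists k, 0; rewrite mulr0z mulr0 addr0 -pmulrn.
have ptB (a b a' b' c d : R) : period_comb a b + period_comb a' b' - k%:R * period_comb c d =
    - period_comb (k%:R * c - a' - a) (k%:R * d - b' - b).
  by rewrite /period_comb !rmorphB !rmorphM !rmorph_nat; ring.
have bnd (a b a' b' c d : R) : `|k%:R * c - a' - a| < e / (pi *+ 2 + 8) ->
    `|k%:R * d - b' - b| < e / (pi *+ 2 + 8) ->
    normc (period_comb a b + period_comb a' b' - k%:R * period_comb c d) < e.
  by move=> ha hb; rewrite ptB normcN -[ltRHS](divfK (lt0r_neq0 p2)); exact: normc_period_comb.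
move=> j; rewrite !mxE !theta2_primD2pi !theta2_coef0 /=.
case: eqVneq => [->|j0]; first by rewrite addrK subrr normc0.
case: eqVneq => [->|j1].
  have := bnd _ _ _ _ _ _ (h 0%N isT) (h 1%N isT).
  congr (normc _ < _); rewrite /= -h1 -halpha; ring.
have -> : j = 2 by case: j j0 j1 => [[|[|[|]]]]// ? _ _; apply/val_inj.
have := bnd _ _ _ _ _ _ (h 2%N isT) (h 3%N isT).
congr (normc _ < _); rewrite /= -h2 -hbeta; ring.
Qed.

End Construction.

Theorem proposition3p1 (R : realType) :
  exists (A : abelianVariety R 3) (f : Cplx R -> A),
    [/\ holomorphic f,
        zariski_dense (range f) &
        ~ exists W : set 'rV[Cplx R]_3,
            algebraic_affine W /\
            zariski_closure (range (jet f)) = [set: A] `*` W].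
Proof.
have [alpha [beta [alpha0 hd]]] := exists_dense_curve_lift R.
exists (ecube R), (curve alpha beta); split.
- exact: holomorphic_curve.
- exact: zariski_dense_curve.
- exact: jet_closure_not_product.
Qed.
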